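(* Let $G$ be a countable discrete group, let $H\in\mathrm{Sub}_{\rm sg}(G)$ be a subgroup with the spectral gap property, let $\sigma$ be a finite dimensional irreducible unitary representation of $H$, and let $\pi:=\mathrm{Ind}_H^G\sigma$. Then the $C^*$-algebra $C^*_\pi(G)$ contains a (unique) smallest non-zero ideal $I_{\rm min}$, that is, a non-zero closed two-sided ideal which is contained in every non-zero closed two-sided ideal of $C^*_\pi(G)$.
   Context: $\mathrm{Ind}_H^G\sigma$ is the (unitarily) induced representation. For a unitary representation $\pi$ of $G$ on a Hilbert space $\mathcal{H}$, $C^*_\pi(G)$ is the norm closure in $\mathcal{B}(\mathcal{H})$ of the linear span of $\pi(G)$. Every unitary representation of a group $\Gamma$ is extended to the maximal $C^*$-algebra $C^*(\Gamma)$; $\rho$ is weakly contained in $\pi$ if $\|\rho(x)\|\le\|\pi(x)\|$ for all $x\in C^*(\Gamma)$. An action of a group $\Gamma$ on a set $X$ has a spectral gap if the natural unitary representation of $\Gamma$ on $\ell^2(X)$ does not weakly contain the trivial representation $1_\Gamma$. A subgroup $H$ of $G$ has the spectral gap property if the action by left translation of $H$ on $G/H\setminus\{H\}$ has a spectral gap. $\mathrm{Sub}_{\rm sg}(G)$ is the set of all such subgroups. *)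

(* Defs.v *)
From HB Require Import structures.
From mathcomp Require Import all_boot all_order all_algebra finmap.
From mathcomp Require Import sesquilinear complex.
From mathcomp Require Import all_classical all_reals.
From mathcomp Require Import topology normedtype.
From mathcomp.analysis.showcase Require Import summability.
From mathcomp Require Import generic_quotient ring.

Set Implicit Arguments.
Unset Strict Implicit.
Unset Printing Implicit Defensive.
Import Order.TTheory GRing.Theory Num.Theory.
Import numFieldNormedType.Exports.
Local Open Scope classical_set_scope.
Local Open Scope ring_scope.

(* The library only puts the norm topology on the alias `R[i]^o`. *)
HB.instance Definition _ (R : realType) := NormedModule.copy R[i] R[i]^o.

Section ComplexComplete.
Local Open Scope complex_scope.
Variable R : realType.

Lemma ler_Re_norm (z : R[i]) : `|complex.Re z|%:C <= `|z|.
Proof.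
rewrite normc_def lecR -sqrtr_sqr ler_wsqrtr// lerDl sqr_ge0 //.
Qed.

Lemma ler_Im_norm (z : R[i]) : `|complex.Im z|%:C <= `|z|.
Proof.
rewrite normc_def lecR -sqrtr_sqr ler_wsqrtr// lerDr sqr_ge0 //.
Qed.

Lemma ler_norm_ReIm (z : R[i]) :
  `|z| <= (`|complex.Re z| + `|complex.Im z|)%:C.
Proof.
rewrite normc_def lecR.
rewrite -[leRHS]ger0_norm ?addr_ge0// -sqrtr_sqr ler_wsqrtr// sqrrD !real_normK ?num_real//.
by rewrite -addrA [_ *+ _ + _]addrC addrA lerDl mulrn_wge0// mulr_ge0.
Qed.

Lemma complex_complete (F : set_system R[i]) :
  ProperFilter F -> cauchy F -> cvg F.
Proof.
move=> FF /cauchyP Fc; apply/cvg_ex.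
have cR (e : R) : 0 < e -> exists x, (@complex.Re R @ F) (ball x e).
  move=> e0; have /Fc[x Fx] : 0 < e%:C by rewrite ltcR.
  exists (complex.Re x); rewrite /fmap/=; apply: filterS Fx => y.
  rewrite -!ball_normE /= => xy; rewrite -raddfB /= -ltcR.
  exact: le_lt_trans (ler_Re_norm _) xy.
have cI (e : R) : 0 < e -> exists x, (@complex.Im R @ F) (ball x e).
  move=> e0; have /Fc[x Fx] : 0 < e%:C by rewrite ltcR.
  exists (complex.Im x); rewrite /fmap/=; apply: filterS Fx => y.
  rewrite -!ball_normE /= => xy; rewrite -raddfB /= -ltcR.
  exact: le_lt_trans (ler_Im_norm _) xy.
have /cauchyP/cauchy_cvg/cvg_ex[a Fa] := cR.
have /cauchyP/cauchy_cvg/cvg_ex[b Fb] := cI.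
exists (a +i* b).
apply/cvgrPdist_lt => e e0.
have eE : e = (complex.Re e)%:C by rewrite RRe_real// gtr0_real.
have re0 : 0 < complex.Re e / 2 by rewrite divr_gt0// -ltcR -eE.
move/cvgrPdist_lt/(_ _ re0) : Fa => /= Fa.
move/cvgrPdist_lt/(_ _ re0) : Fb => /= Fb.
rewrite near_map in Fa; rewrite near_map in Fb.
near=> z.
rewrite eE (splitr (complex.Re e)).
apply: le_lt_trans (ler_norm_ReIm _) _.
rewrite ltcR ltrD//.
- rewrite raddfB; near: z; exact: Fa.
- rewrite raddfB; near: z; exact: Fb.
Unshelve. all: by end_near. Qed.
End ComplexComplete.
HB.instance Definition _ (R : realType) :=
  Uniform_isComplete.Build R[i] (@complex_complete R).

(* The inner product is linear in its first argument and conjugate-linear in the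
   second. *)
HB.mixin Record isHilbert (R : realType) V of CompleteNormedModule R[i] V := {
  inner : {dot V for Num.Def.conjC};
  normr_inner : forall u : V, `|u| = sqrtC (inner u u)
}.

#[short(type="hilbertType")]
HB.structure Definition Hilbert (R : realType) :=
  {V of isHilbert R V & CompleteNormedModule R[i] V}.

Section DotNorm.
Variables (C : numClosedFieldType) (V : lmodType C).
Variable form : {dot V for Num.Def.conjC}.

Definition dot_norm (u : V) : C := sqrtC (form u u).

Lemma dot_norm_sqr u : dot_norm u ^+ 2 = form u u.
Proof. exact: sqrtCK. Qed.

Lemma dot_norm_ge0 u : 0 <= dot_norm u.
Proof. exact: sqrt_dnorm_ge0. Qed.

Lemma dot_norm0_eq0 u : dot_norm u = 0 -> u = 0.
Proof. by move/eqP; rewrite sqrt_dnorm_eq0 => /eqP. Qed.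

Lemma dot_normZ (a : C) u : dot_norm (a *: u) = `|a| * dot_norm u.
Proof.
apply/eqP; rewrite -(@eqrXn2 _ 2)// ?mulr_ge0 ?dot_norm_ge0//.
by rewrite exprMn !dot_norm_sqr dnormZ.
Qed.

Lemma dot_CauchySchwarz u v : `|form u v| <= dot_norm u * dot_norm v.
Proof.
have [->|v0] := eqVneq v 0.
  by rewrite linear0r normr0 mulr_ge0 ?dot_norm_ge0.
have fv0 : 0 < form v v by rewrite dnorm_gt0.
rewrite -(@ler_pXn2r _ 2) ?nnegrE ?mulr_ge0 ?dot_norm_ge0//.
rewrite exprMn !dot_norm_sqr.
pose a := form u v / form v v.
have := dnorm_ge0 form (u - a *: v).
rewrite dnormB dnormZ linearZr_LR/=.
have -> : `|a| ^+ 2 * form v v = `|form u v| ^+ 2 / form v v.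
  rewrite /a normf_div (ger0_norm (ltW fv0)); field.
  by rewrite gt_eqF.
have -> : a^* * form u v = `|form u v| ^+ 2 / form v v.
  rewrite /a rmorphM/= fmorphV/= (geC0_conj (ltW fv0)) normCK; field.
  by rewrite gt_eqF.
set q := _ / _.
have -> : q^* = q by apply: geC0_conj; rewrite divr_ge0 ?exprn_ge0// ltW.
rewrite opprD addrACA subrr addr0 subr_ge0 /q.
by rewrite ler_pdivrMr// mulrC.
Qed.

Lemma ler_dot_normD u v : dot_norm (u + v) <= dot_norm u + dot_norm v.
Proof.
rewrite -(@ler_pXn2r _ 2) ?nnegrE ?addr_ge0 ?dot_norm_ge0//.
rewrite sqrrD !dot_norm_sqr dnormD [leRHS]addrAC lerD2l.
apply: le_trans (_ : `|form u v| *+ 2 <= _); last first.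
  by rewrite lerMn2r /= dot_CauchySchwarz.
have -> : form u v + (form u v)^* = 'Re (form u v) *+ 2.
  by rewrite ReE -mulr_natr divfK ?pnatr_eq0.
by rewrite lerMn2r /=; case: (leif_Re_Creal (form u v)).
Qed.
End DotNorm.

(* A positive definite form in the sense of `{dot U for conjC}` from the usual
   axioms of a complex inner product. *)
HB.factory Record isInnerProduct (C : numClosedFieldType) (U : lmodType C)
    (f : U -> U -> C) := {
  inner_linear : forall v, scalar (f^~ v);
  inner_conj : forall u v, f u v = (f v u)^*;
  inner_gt0 : forall u, u != 0 -> 0 < f u u
}.
HB.builders Context C U f of isInnerProduct C U f.
Let f_bilinear : bilinear_for
  (GRing.Scale.Law.clone _ _ *%R _)
  (GRing.Scale.Law.clone _ _ (Num.Def.conjC \; *%R) _) f.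
Proof.
split=> u a x y /=; first exact: inner_linear.
by rewrite inner_conj inner_linear rmorphD rmorphM/= -!inner_conj.
Qed.
HB.instance Definition _ := bilinear_isBilinear.Build _ _ _ _ _ _ f f_bilinear.
Let f_hermitian x y : f x y = (-1) ^+ false * Num.Def.conjC (f y x).
Proof. by rewrite expr0 mul1r; exact: inner_conj. Qed.
HB.instance Definition _ :=
  isHermitianSesquilinear.Build _ _ _ _ f f_hermitian.
HB.instance Definition _ := isDotProduct.Build _ _ f inner_gt0.
HB.end.

Section ComplexHilbert.
Variable R : realType.

Definition complex_dot (x y : R[i]) : R[i] := x * y^*.

Let complex_dot_linear y : scalar (complex_dot^~ y).
Proof. by move=> a u v; rewrite /complex_dot mulrDl mulrA. Qed.
Let complex_dot_conj x y : complex_dot x y = (complex_dot y x)^*.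
Proof. by rewrite /complex_dot rmorphM/= conjCK mulrC. Qed.
Let complex_dot_gt0 x : x != 0 -> 0 < complex_dot x x.
Proof. by move=> x0; rewrite /complex_dot -normCK exprn_gt0// normr_gt0. Qed.
HB.instance Definition _ := isInnerProduct.Build _ _ complex_dot
  complex_dot_linear complex_dot_conj complex_dot_gt0.

Let complex_normr_dot (x : R[i]) : `|x| = sqrtC (complex_dot x x).
Proof. by rewrite /complex_dot -normCK sqrCK. Qed.
HB.instance Definition _ := isHilbert.Build R R[i] complex_normr_dot.
End ComplexHilbert.

#[export] Existing Instance totally_filter.

Lemma partial_sumE (X : choiceType) (M : zmodType) (a : X -> M) (A : {fset X}) :
  partial_sum a A = \sum_(x <- A) a x.
Proof. by rewrite /partial_sum big_seq_fsetE. Qed.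

Lemma big_fset_splitD (X : choiceType) (M : zmodType) (a : X -> M)
    (A B : {fset X}) : (A `<=` B)%fset ->
  \sum_(x <- B) a x = \sum_(x <- A) a x + \sum_(x <- (B `\` A)%fset) a x.
Proof.
move=> AB; rewrite (big_fsetID _ (mem A) B) /=; congr (_ + _).
  apply: eq_fbigl => x; rewrite !inE /=.
  by apply: andb_idl => /(fsubsetP AB).
by apply: eq_fbigl => x; rewrite !inE /= andbC.
Qed.

(* `summability.sum a` is the unordered sum of `a`: the limit of the sums over the
   finite subsets, directed by inclusion. *)
Section ComplexSums.
Variable R : realType.
Local Notation C := R[i].

Lemma complex_cvg_ge (T : Type) (F : set_system T) (f : T -> C) (l c : C) :
  ProperFilter F -> f x @[x --> F] --> l -> (\forall x \near F, c <= f x) -> c <= l.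
Proof.
move=> FF fl fc; rewrite -subr_ge0.
have h1 : f x - c @[x --> F] --> l - c by apply: cvgB; [exact: fl|exact: cvg_cst].
have h2 : f x - c @[x --> F] --> `|l - c|.
  apply: cvg_trans (cvg_norm h1); apply: near_eq_cvg.
  by near=> x; rewrite ger0_norm// subr_ge0; near: x.
suff -> : l - c = `|l - c| by [].
exact: (cvg_unique (@norm_hausdorff _ C) h1 h2).
Unshelve. all: by end_near. Qed.

Lemma complex_cvg_le (T : Type) (F : set_system T) (f : T -> C) (l c : C) :
  ProperFilter F -> f x @[x --> F] --> l -> (\forall x \near F, f x <= c) -> l <= c.
Proof.
move=> FF fl fc; rewrite -lerN2; apply: (@complex_cvg_ge _ F (fun x => - f x)).
  exact: cvgN.
by near=> x; rewrite lerN2; near: x.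
Unshelve. all: by end_near. Qed.

Lemma abs_summable_cvg (X : choiceType) (a : X -> C) (M : C) :
  (forall A : {fset X}, \sum_(x <- A) `|a x| <= M) ->
  cvg (partial_sum a @ totally).
Proof.
move=> aM; apply/cauchy_cvgP/cauchy_exP => e e0.
pose s (A : {fset X}) : R := complex.Re (\sum_(x <- A) `|a x|).
have sE A : (s A)%:C%C = \sum_(x <- A) `|a x|.
  by rewrite RRe_real// ger0_real// sumr_ge0.
have ME : M = (complex.Re M)%:C%C.
  rewrite RRe_real// ger0_real//; apply: le_trans (aM fset0).
  by rewrite big_seq_fset0.
have eE : e = (complex.Re e)%:C%C by rewrite RRe_real// gtr0_real.
have re0 : 0 < complex.Re e by rewrite -ltcR -eE.
have hs : has_sup (range s).
  split; first by exists (s fset0), fset0.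
  by exists (complex.Re M) => _ [A _ <-]; rewrite -lecR sE -ME.
have [_ [A0 _ <-] A0e] := sup_adherent re0 hs.
exists (partial_sum a A0); exists A0 => // A /= A0A.
rewrite -ball_normE /= !partial_sumE (big_fset_splitD _ A0A) opprD addNKr normrN.
apply: le_lt_trans (ler_norm_sum _ _ _) _.
have -> : \sum_(i <- (A `\` A0)%fset) `|a i| = (s A - s A0)%:C%C.
  by rewrite rmorphB/= !sE (big_fset_splitD _ A0A) addrC addKr.
rewrite eE ltcR ltrBlDl -ltrBlDr; apply: le_lt_trans A0e.
by rewrite lerB//; apply: sup_upper_bound => //; exists A.
Qed.

Lemma sum_ge0_partial (X : choiceType) (a : X -> C) (A : {fset X}) :
  (forall x, 0 <= a x) -> cvg (partial_sum a @ totally) ->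
  \sum_(x <- A) a x <= summability.sum a.
Proof.
move=> a0 acvg; apply: (@complex_cvg_ge _ totally (partial_sum a) _ _ _ acvg).
exists A => // B /= AB; rewrite partial_sumE (big_fset_splitD _ AB) lerDl.
by rewrite sumr_ge0.
Qed.

Lemma sum_le_bound (X : choiceType) (a : X -> C) (M : C) :
  cvg (partial_sum a @ totally) ->
  (forall A : {fset X}, \sum_(x <- A) a x <= M) -> summability.sum a <= M.
Proof.
move=> acvg aM; apply: (@complex_cvg_le _ totally (partial_sum a) _ _ _ acvg).
by apply: nearW => A; rewrite partial_sumE.
Qed.

End ComplexSums.

Lemma cauchy_filter_cvg (K : numFieldType) (M : normedModType K)
    (F : set_system M) (h : M) : ProperFilter F -> cauchy F ->
  (forall f e, 0 < e -> F (ball f e) -> `|h - f| <= e) -> cvg F.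
Proof.
move=> FF /cauchyP Fc hF; apply/cvg_ex; exists h; apply/cvgrPdist_lt => e e0.
have e20 : 0 < e / 2 by rewrite divr_gt0.
have [f Ff] := Fc _ e20; apply: filterS (Ff) => g fg.
rewrite -(subrKA f) (splitr e); apply: le_lt_trans (ler_normD _ _) _.
by rewrite ler_ltD//; [exact: hF|move: fg; rewrite -ball_normE].
Qed.

Lemma cvg_sum_seq (K : numFieldType) (M : normedModType K) (T I : Type)
    (F : set_system T) (s : seq I) (f : I -> T -> M) (l : I -> M) : Filter F ->
  (forall i, f i t @[t --> F] --> l i) ->
  \sum_(i <- s) f i t @[t --> F] --> \sum_(i <- s) l i.
Proof.
move=> FF fl; elim: s => [|i s IHs].
  by rewrite big_nil; under eq_cvg do rewrite big_nil; exact: cvg_cst.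
rewrite big_cons; under eq_cvg do rewrite big_cons.
by apply: cvgD; [exact: fl|exact: IHs].
Qed.

Section SquareSummable.
Variables (R : realType) (X : choiceType) (V : hilbertType R).
Implicit Types f g : X -> V.

(* A bound `M` in `R[i]` of a sum of squares is automatically real: the order of
   `R[i]` only compares elements with the same imaginary part. *)
Definition sqsummable f : Prop :=
  exists M : R[i], forall A : {fset X}, \sum_(x <- A) `|f x| ^+ 2 <= M.

Definition sqsummable_pred : {pred X -> V} := fun f => `[< sqsummable f >].

Lemma sqsummable_submod : GRing.submod_closed sqsummable_pred.
Proof.
split=> [|a f g /asboolP[M fM] /asboolP[N gN]]; apply/asboolP.
  by exists 0 => A; rewrite big1// => x _; rewrite normr0 expr0n.
exists (`|a| ^+ 2 * M *+ 2 + N *+ 2) => A.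
apply: (@le_trans _ _
    (\sum_(x <- A) ((`|a| ^+ 2 * `|f x| ^+ 2) *+ 2 + `|g x| ^+ 2 *+ 2))).
  apply: ler_sum => x _.
  apply: (@le_trans _ _ ((`|a| * `|f x| + `|g x|) ^+ 2)).
    by rewrite ler_sqr ?nnegrE ?addr_ge0 ?mulr_ge0// -normrZ ler_normD.
  rewrite -subr_ge0 -exprMn.
  have -> : (`|a| * `|f x|) ^+ 2 *+ 2 + `|g x| ^+ 2 *+ 2 -
      (`|a| * `|f x| + `|g x|) ^+ 2 = (`|a| * `|f x| - `|g x|) ^+ 2 by ring.
  by rewrite real_exprn_even_ge0 ?rpredB ?rpredM ?normr_real.
rewrite big_split/= !sumrMnl -mulr_sumr lerD// lerMn2r//=.
by rewrite ler_wpM2l ?exprn_ge0.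
Qed.

Lemma sqsummable_inner_cvg f g : sqsummable f -> sqsummable g ->
  cvg (partial_sum (fun x => inner (f x) (g x)) @ totally).
Proof.
move=> [M fM] [N gN]; apply: (@abs_summable_cvg _ _ _ (M + N)) => A.
apply: le_trans (lerD (fM A) (gN A)); rewrite -big_split/=.
apply: ler_sum => x _; apply: le_trans (dot_CauchySchwarz _ _ _) _.
rewrite /dot_norm -!normr_inner -subr_ge0.
have -> : `|f x| ^+ 2 + `|g x| ^+ 2 - `|f x| * `|g x| =
  2^-1 * (`|f x| ^+ 2 + `|g x| ^+ 2 + (`|f x| - `|g x|) ^+ 2) by field.
rewrite mulr_ge0 ?invr_ge0// addr_ge0//; first by rewrite addr_ge0 ?exprn_ge0.
by rewrite real_exprn_even_ge0 ?rpredB ?normr_real.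
Qed.

End SquareSummable.

Lemma normr_inner_sqr (R : realType) (V : hilbertType R) (u : V) :
  `|u| ^+ 2 = inner u u.
Proof. by rewrite normr_inner sqrtCK. Qed.

(* The Hilbert space of square-summable families of elements of `V` indexed by `X`;
   `l2 X R[i]` is the usual space. *)
Section L2.
Variables (R : realType) (X : choiceType) (V : hilbertType R).

Record l2 : Type := L2 {
  l2_fun :> X -> V;
  l2_sqsummable : l2_fun \in @sqsummable_pred R X V }.

HB.instance Definition _ := [isSub for l2_fun].
HB.instance Definition _ := [Choice of l2 by <:].
HB.instance Definition _ :=
  GRing.SubChoice_isSubLmodule.Build _ _ _ l2 (@sqsummable_submod R X V).

Definition l2_inner (f g : l2) : R[i] :=
  summability.sum (fun x => inner (f x) (g x)).

Lemma l2P (f : l2) : sqsummable f.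
Proof. exact/asboolP/l2_sqsummable. Qed.

Lemma l2_inner_cvg (f g : l2) :
  cvg (partial_sum (fun x => inner (f x) (g x)) @ totally).
Proof. by apply: sqsummable_inner_cvg; exact: l2P. Qed.

Let l2_inner_linear g : scalar (l2_inner^~ g).
Proof.
move=> a u v; apply: (cvg_lim (@norm_hausdorff _ R[i])).
have h := @cvgD _ R[i] _ totally _ _ _ _ _
  (@cvgZl_tmp _ R[i] _ totally _ a _ _ (@l2_inner_cvg u g)) (@l2_inner_cvg v g).
suff -> : partial_sum (fun x => inner ((a *: u + v) x) (g x)) =
    (fun A => a *: partial_sum (fun x => inner (u x) (g x)) A +
      partial_sum (fun x => inner (v x) (g x)) A) by exact: h.
apply/funext => A.
rewrite !partial_sumE scaler_sumr -big_split/=; apply: eq_bigr => x _.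
by rewrite linearDl linearZl_LR.
Qed.

Let l2_inner_conj f g : l2_inner f g = (l2_inner g f)^*.
Proof.
apply: (cvg_lim (@norm_hausdorff _ R[i])).
apply/cvgrPdist_lt => e e0.
have /cvgrPdist_lt/(_ _ e0) := @l2_inner_cvg g f.
apply: filterS => A; rewrite -norm_conjC rmorphB/=.
congr (`|_ - _| < _); rewrite !partial_sumE rmorph_sum/=.
apply: eq_bigr => x _; rewrite [RHS](hermC inner) expr0 mul1r//.
Qed.

Lemma l2_inner_ge_partial (f : l2) (A : {fset X}) :
  \sum_(x <- A) `|f x| ^+ 2 <= l2_inner f f.
Proof.
rewrite (eq_bigr _ (fun x _ => normr_inner_sqr (f x))).
apply: sum_ge0_partial (@l2_inner_cvg f f) => x; exact: dnorm_ge0.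
Qed.

Lemma l2_inner_le (f : l2) (M : R[i]) :
  (forall A : {fset X}, \sum_(x <- A) `|f x| ^+ 2 <= M) -> l2_inner f f <= M.
Proof.
move=> fM; apply: (sum_le_bound (@l2_inner_cvg f f)) => A.
by rewrite -(eq_bigr _ (fun x _ => normr_inner_sqr (f x))).
Qed.

Let l2_inner_gt0 f : f != 0 -> 0 < l2_inner f f.
Proof.
move=> f0; have [x fx] : exists x, f x != 0.
  apply: contrapT => fx; move/eqP: f0; apply; apply/val_inj/funext => x /=.
  by apply: contrapT => /eqP fx0; apply: fx; exists x.
apply: lt_le_trans (l2_inner_ge_partial f [fset x]%fset).
by rewrite big_seq_fset1 exprn_gt0// normr_gt0.
Qed.

HB.instance Definition _ := isInnerProduct.Build _ _ l2_inner
  l2_inner_linear l2_inner_conj l2_inner_gt0.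

HB.instance Definition _ := Lmodule_isNormed.Build R[i] l2
  (ler_dot_normD l2_inner) (dot_normZ l2_inner) (@dot_norm0_eq0 _ _ l2_inner).

Lemma l2_normE (f : l2) : `|f| = sqrtC (l2_inner f f).
Proof. by []. Qed.

Lemma l2_norm_ge_partial (f : l2) (A : {fset X}) :
  \sum_(x <- A) `|f x| ^+ 2 <= `|f| ^+ 2.
Proof. by rewrite l2_normE sqrtCK l2_inner_ge_partial. Qed.

Lemma l2_norm_ge (f : l2) x : `|f x| <= `|f|.
Proof.
rewrite -ler_sqr ?nnegrE//.
by have := l2_norm_ge_partial f [fset x]%fset; rewrite big_seq_fset1.
Qed.

Lemma l2_norm_le (f : l2) (M : R[i]) : 0 <= M ->
  (forall A : {fset X}, \sum_(x <- A) `|f x| ^+ 2 <= M ^+ 2) -> `|f| <= M.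
Proof.
by move=> M0 fM; rewrite -ler_sqr ?nnegrE// l2_normE sqrtCK l2_inner_le.
Qed.

Let l2_complete (F : set_system l2) : ProperFilter F -> cauchy F -> cvg F.
Proof.
move=> FF Fc.
have Fx x : cvg ((fun f : l2 => f x) @ F).
  apply/cauchy_cvgP/cauchy_exP => e e0.
  have /cauchyP/(_ _ e0)[f Ff] := Fc; exists (f x).
  rewrite /fmap/=; apply: filterS Ff => g.
  rewrite -!ball_normE /=; apply: le_lt_trans.
  exact: (l2_norm_ge (f - g)).
pose h x := lim ((fun f : l2 => f x) @ F).
have hF (f : l2) e (A : {fset X}) : 0 < e -> F (ball f e) ->
    \sum_(x <- A) `|h x - f x| ^+ 2 <= e ^+ 2.
  move=> e0 Ffe.
  apply: (@complex_cvg_le _ _ F (fun g : l2 => \sum_(x <- A) `|g x - f x| ^+ 2)).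
    apply: cvg_sum_seq => x.
    by apply: cvgM; apply: cvg_norm; apply: cvgB; do ?[exact: Fx|exact: cvg_cst].
  apply: filterS Ffe => g; rewrite -ball_normE /= distrC => /ltW ge.
  apply: le_trans (l2_norm_ge_partial (g - f) A) _.
  by rewrite ler_sqr ?nnegrE// ltW.
have hs : h \in @sqsummable_pred R X V.
  have /cauchyP/(_ _ ltr01)[f Ff] := Fc.
  rewrite -(subrK (f : X -> V) h) -[h - _]scale1r.
  have [_ ->] := @sqsummable_submod R X V => //.
    by apply/asboolP; exists (1 ^+ 2) => A; exact: hF.
  exact: l2_sqsummable.
apply: (@cauchy_filter_cvg _ _ F (L2 hs)) => // f e e0 Ff.
apply: l2_norm_le; first exact: ltW.
by move=> A; exact: hF.
Qed.

HB.instance Definition _ := Uniform_isComplete.Build l2 l2_complete.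
HB.instance Definition _ := isHilbert.Build R l2 l2_normE.
End L2.

(* The algebra of bounded linear operators of `V`, with composition as product and
   with the operator norm. The trivial space is allowed, so 1 = 0 may hold. *)
Section BoundedOperators.
Variables (R : realType) (V : hilbertType R).

Definition bop_pred : {pred V -> V} := fun T =>
  `[< linear T /\ exists M : R[i], forall u, `|T u| <= M * `|u| >].

Lemma bop_submod : GRing.submod_closed bop_pred.
Proof.
split=> [|a S T /asboolP[Sl [M SM]] /asboolP[Tl [N TN]]]; apply/asboolP.
  split=> [b u v|]; first by rewrite /= scaler0 addr0.
  by exists 0 => u; rewrite normr0 mul0r.
split=> [b u v|].
  rewrite -![(a *: S + T) _]/(a *: S _ + T _) Sl Tl.
  by rewrite !scalerDr !scalerA mulrC addrACA.
exists (`|a| * M + N) => u; rewrite mulrDl -mulrA.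
apply: le_trans (ler_normD _ _) _; rewrite normrZ.
by rewrite lerD ?ler_wpM2l.
Qed.

Record bop : Type := Bop { bop_fun :> V -> V; bop_proof : bop_fun \in bop_pred }.

HB.instance Definition _ := [isSub for bop_fun].
HB.instance Definition _ := [Choice of bop by <:].
HB.instance Definition _ :=
  GRing.SubChoice_isSubLmodule.Build _ _ _ bop bop_submod.

Lemma bop_linear (T : bop) : linear T.
Proof. by case: T => T /= /asboolP[]. Qed.
HB.instance Definition _ (T : bop) :=
  GRing.isLinear.Build _ _ _ _ (bop_fun T) (bop_linear T).

Lemma bop_eqP (S T : bop) : (forall u, S u = T u) -> S = T.
Proof. by move=> ST; apply/val_inj/funext. Qed.

Lemma bop_bounded (T : bop) :
  exists2 M : R, 0 <= M & forall u, `|T u| <= M%:C%C * `|u|.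
Proof.
case: (T) => {}T /= /asboolP[_ [M TM]].
exists (complex.Re `|M|) => [|u]; first by rewrite -ler0c RRe_real ?normr_real.
rewrite RRe_real ?normr_real//; apply: le_trans (TM u) _.
have Mu0 : 0 <= M * `|u| := le_trans (normr_ge0 _) (TM u).
by rewrite -[leLHS](ger0_norm Mu0) normrM normr_id.
Qed.

Let comp_bop_subproof (S T : bop) : (fun u => S (T u)) \in bop_pred.
Proof.
apply/asboolP; split=> [a u v|]; first by rewrite !linearP.
have [M M0 SM] := bop_bounded S; have [N _ TN] := bop_bounded T.
exists (M%:C%C * N%:C%C) => u; rewrite -mulrA; apply: le_trans (SM _) _.
by rewrite ler_wpM2l ?ler0c.
Qed.
Definition comp_bop (S T : bop) : bop := Bop (comp_bop_subproof S T).

Let id_bop_subproof : idfun \in bop_pred.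
Proof. by apply/asboolP; split=> //; exists 1 => u; rewrite mul1r. Qed.
Definition id_bop : bop := Bop id_bop_subproof.

Let comp_bopA : associative comp_bop.
Proof. by move=> S T U; apply: bop_eqP. Qed.
Let comp_id_bop : left_id id_bop comp_bop.
Proof. by move=> T; apply: bop_eqP. Qed.
Let comp_bop_id : right_id id_bop comp_bop.
Proof. by move=> T; apply: bop_eqP. Qed.
Let comp_bopDl : left_distributive comp_bop +%R.
Proof. by move=> S T U; apply: bop_eqP. Qed.
Let comp_bopDr : right_distributive comp_bop +%R.
Proof. by move=> S T U; apply: bop_eqP => u; exact: (raddfD S). Qed.
HB.instance Definition _ := GRing.Zmodule_isPzRing.Build bop
  comp_bopA comp_id_bop comp_bop_id comp_bopDl comp_bopDr.

Lemma bop_scaleAl (a : R[i]) (S T : bop) : a *: (S * T) = (a *: S) * T.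
Proof. exact: bop_eqP. Qed.
Lemma bop_scaleAr (a : R[i]) (S T : bop) : a *: (S * T) = S * (a *: T).
Proof. by apply: bop_eqP => u; exact/esym/(linearZ_LR S). Qed.

(* Norms take values in `R[i]`, and suprema are only available in `R`. *)
Definition opnorm (T : bop) : R[i] :=
  (sup [set complex.Re `|T u| | u in [set u | `|u| <= 1]])%:C%C.

Let opnorm_has_sup (T : bop) :
  has_sup [set complex.Re `|T u| | u in [set u | `|u| <= 1]].
Proof.
split; first by exists (complex.Re `|T 0|), 0; rewrite /= ?normr0.
have [M M0 TM] := bop_bounded T; exists M => _ [u /= u1 <-].
rewrite -lecR RRe_real ?normr_real//; apply: le_trans (TM u) _.
by rewrite ler_piMr ?ler0c.
Qed.

Lemma opnorm_ge0 T : 0 <= opnorm T.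
Proof.
rewrite ler0c; apply: le_trans (_ : complex.Re `|T 0| <= _).
  by rewrite -ler0c RRe_real ?normr_real.
by apply: sup_upper_bound (opnorm_has_sup T) _ _; exists 0; rewrite /= ?normr0.
Qed.

Lemma ler_opnorm (T : bop) u : `|T u| <= opnorm T * `|u|.
Proof.
have [->|u0] := eqVneq u 0; first by rewrite linear0 !normr0 mulr0.
rewrite -ler_pdivrMr ?normr_gt0//.
have -> : `|T u| / `|u| = `|T (`|u|^-1 *: u)|.
  by rewrite linearZ normrZ normfV normr_id mulrC.
rewrite -[leLHS]RRe_real ?normr_real// lecR.
apply: sup_upper_bound (opnorm_has_sup T) _ _; exists (`|u|^-1 *: u) => //=.
by rewrite normrZ normfV normr_id mulVf ?normr_eq0.
Qed.

Lemma opnorm_le (T : bop) (M : R[i]) : 0 <= M ->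
  (forall u, `|T u| <= M * `|u|) -> opnorm T <= M.
Proof.
move=> M0 TM; rewrite -[M]RRe_real ?ger0_real// lecR.
apply: ge_sup => [|_ [u /= u1 <-]].
  by have [] := opnorm_has_sup T.
rewrite -lecR !RRe_real ?normr_real ?ger0_real//.
by apply: le_trans (TM u) _; rewrite ler_piMr.
Qed.

Let ler_opnormD S T : opnorm (S + T) <= opnorm S + opnorm T.
Proof.
apply: opnorm_le => [|u]; first by rewrite addr_ge0 ?opnorm_ge0.
by rewrite mulrDl (le_trans (ler_normD _ _))// lerD// ler_opnorm.
Qed.

Let opnormZ a T : opnorm (a *: T) = `|a| * opnorm T.
Proof.
have le b U : opnorm (b *: U) <= `|b| * opnorm U.
  apply: opnorm_le => [|u]; first by rewrite mulr_ge0 ?opnorm_ge0.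
  by rewrite normrZ -mulrA ler_wpM2l ?ler_opnorm.
apply/le_anti; rewrite le /=.
have [->|a0] := eqVneq a 0; first by rewrite normr0 mul0r opnorm_ge0.
rewrite -ler_pdivlMl ?normr_gt0// -normfV.
by rewrite -[in leLHS](scalerK a0 T) le.
Qed.

Let opnorm0_eq0 T : opnorm T = 0 -> T = 0.
Proof.
move=> T0; apply: bop_eqP => u; apply/eqP; rewrite -normr_le0.
by have := ler_opnorm T u; rewrite T0 mul0r.
Qed.

HB.instance Definition _ :=
  Lmodule_isNormed.Build R[i] bop ler_opnormD opnormZ opnorm0_eq0.

Lemma bop_normE (T : bop) : `|T| = opnorm T. Proof. by []. Qed.

Let bop_complete (F : set_system bop) : ProperFilter F -> cauchy F -> cvg F.
Proof.
move=> FF Fc.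
have Fu u : cvg ((fun T : bop => T u) @ F).
  apply/cauchy_cvgP/cauchy_exP => e e0.
  have d0 : 0 < e / (1 + `|u|) by rewrite divr_gt0// ltr_pwDl.
  have /cauchyP/(_ _ d0)[S FS] := Fc; exists (S u).
  rewrite /fmap/=; apply: filterS FS => T.
  rewrite -!ball_normE /= => ST.
  apply: le_lt_trans (ler_opnorm (S - T) u) _.
  apply: le_lt_trans (_ : _ <= e / (1 + `|u|) * `|u|) _.
    by rewrite ler_wpM2r// ltW.
  by rewrite -mulrA gtr_pMr// mulrC ltr_pdivrMr ?mul1r ?ltr_pwDl// ltrDr.
pose h u := lim ((fun T : bop => T u) @ F).
have hF (S : bop) e u : 0 < e -> F (ball S e) -> `|h u - S u| <= e * `|u|.
  move=> e0 FS.
  apply: (@complex_cvg_le _ _ F (fun T : bop => `|T u - S u|)).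
    by apply: cvg_norm; apply: cvgB; [exact: Fu|exact: cvg_cst].
  apply: filterS FS => T; rewrite -ball_normE /= distrC => /ltW TS.
  by apply: le_trans (ler_opnorm (T - S) u) _; rewrite ler_wpM2r.
have hb : h \in bop_pred.
  apply/asboolP; split=> [a u v|].
    apply: (cvg_lim (@norm_hausdorff _ V)).
    suff -> : (fun T : bop => T (a *: u + v)) = (fun T => a *: T u + T v).
      by apply: cvgD; [apply: cvgZl_tmp; exact: Fu|exact: Fu].
    by apply/funext => T; rewrite linearP.
  have /cauchyP/(_ _ ltr01)[S FS] := Fc.
  exists (1 + opnorm S) => u; rewrite mulrDl -[h u](subrK (S u)).
  apply: le_trans (ler_normD _ _) _; apply: lerD (ler_opnorm S u).
  exact: hF.
apply: (@cauchy_filter_cvg _ _ F (Bop hb)) => // S e e0 FS.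
by apply: opnorm_le => [|u]; [exact: ltW|exact: hF].
Qed.
HB.instance Definition _ := Uniform_isComplete.Build bop bop_complete.
End BoundedOperators.

Section SumReindex.
Variables (R : realType) (X : choiceType).

Lemma big_fset_reindex (M : zmodType) (s t : X -> X) (a : X -> M)
    (A : {fset X}) : cancel s t -> cancel t s ->
  \sum_(x <- A) a (s x) = \sum_(x <- (s @` A)%fset) a x.
Proof.
move=> st ts; rewrite big_imfset//= => x y _ _.
exact: (can_inj st).
Qed.

Lemma sum_reindex (s t : X -> X) (a : X -> R[i]) :
  cancel s t -> cancel t s -> cvg (partial_sum a @ totally) ->
  summability.sum (fun x => a (s x)) = summability.sum a.
Proof.
move=> st ts ca; apply: (cvg_lim (@norm_hausdorff _ R[i])).
apply/cvgrPdist_lt => e e0.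
have /cvgrPdist_lt/(_ _ e0)[A0 _ A0P] := ca.
exists (t @` A0)%fset => // A /= tA.
rewrite partial_sumE (big_fset_reindex _ _ st ts) -partial_sumE.
apply: A0P => /=; apply/fsubsetP => x xA0.
apply/imfsetP; exists (t x) => //=.
by apply: (fsubsetP tA); rewrite in_imfset.
Qed.

End SumReindex.

Section UnitaryRepresentations.
Variable R : realType.

(* `unirep_unitary` makes each operator isometric; it is surjective by the group law. *)
Record unirep (G : groupType) (V : hilbertType R) := Unirep {
  unirep_fun :> G -> bop V;
  unirep1 : unirep_fun 1%g = 1;
  unirepM : forall g h, unirep_fun (g * h)%g = unirep_fun g * unirep_fun h;
  unirep_unitary : forall g u v,
    inner (unirep_fun g u) (unirep_fun g v) = inner u v }.

Lemma unirepK (G : groupType) (V : hilbertType R) (pi : unirep G V) g :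
  cancel (pi g) (pi (g^-1)%g).
Proof.
by move=> u; rewrite -[LHS]/((pi g^-1%g * pi g) u) -unirepM mulVg unirep1.
Qed.

Lemma unirep_norm (G : groupType) (V : hilbertType R) (pi : unirep G V) g u :
  `|pi g u| = `|u|.
Proof. by rewrite !normr_inner unirep_unitary. Qed.

Let trivial_bopM (G : groupType) (g h : G) :
  (fun=> 1 : bop R[i]) (g * h)%g = (fun=> 1) g * (fun=> 1) h.
Proof. by rewrite mulr1. Qed.
Definition trivial_rep (G : groupType) : unirep G R[i] :=
  @Unirep G R[i] (fun=> 1) erefl (@trivial_bopM G) (fun _ _ _ => erefl).

Definition group_algebra (G : groupType) := {fsfun G -> R[i] with 0}.

Definition group_algebra_rep (G : groupType) (V : hilbertType R)
    (pi : unirep G V) (a : group_algebra G) : bop V :=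
  \sum_(g <- finsupp a) a g *: pi g.

(* Cauchy sequences for the maximal norm of the group algebra, which is the supremum
   of the norms in all unitary representations on all Hilbert spaces. *)
Definition cstar_cauchy (G : groupType) (x : nat -> group_algebra G) : Prop :=
  forall e : R[i], 0 < e -> exists N : nat, forall m n, (N <= m)%N -> (N <= n)%N ->
  forall (V : hilbertType R) (pi : unirep G V),
    `|group_algebra_rep pi (x m) - group_algebra_rep pi (x n)| <= e.

(* The maximal C*-algebra is the completion of the group algebra for that norm. Its
   elements are given by Cauchy sequences; two sequences at distance tending to 0
   are not identified, but they have the same image under `cstar_rep pi` below. *)
Record max_cstar (G : groupType) := MaxCstar {
  cstar_seq :> nat -> group_algebra G;
  cstar_seq_cauchy : cstar_cauchy cstar_seq }.

(* The extension of `pi` to the maximal C*-algebra by continuity; the limit is for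
   the operator norm and exists by `cstar_rep_cvg`. *)
Definition cstar_rep (G : groupType) (V : hilbertType R) (pi : unirep G V)
    (x : max_cstar G) : bop V :=
  lim (group_algebra_rep pi (x n) @[n --> \oo]).

Lemma cstar_rep_cvg (G : groupType) (V : hilbertType R) (pi : unirep G V)
    (x : max_cstar G) : cvg (group_algebra_rep pi (x n) @[n --> \oo]).
Proof.
apply/cauchy_cvgP/cauchy_exP => e e0.
have e20 : 0 < e / 2 by rewrite divr_gt0.
have [N xN] := @cstar_seq_cauchy _ x _ e20.
exists (group_algebra_rep pi (x N)); exists N => // n /= Nn.
rewrite -ball_normE /=; apply: le_lt_trans (xN _ _ _ _ _ _) _ => //.
by rewrite ltr_pdivrMr// ltr_pMr// ltr1n.
Qed.

Definition weakly_contained (G : groupType) (V W : hilbertType R)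
    (rho : unirep G V) (pi : unirep G W) : Prop :=
  forall x : max_cstar G, `|cstar_rep rho x| <= `|cstar_rep pi x|.

Record gaction (G : groupType) (X : Type) := Gaction {
  gact :> G -> X -> X;
  gact1 : forall x, gact 1%g x = x;
  gactM : forall g h x, gact (g * h)%g x = gact g (gact h x) }.

Lemma gactK (G : groupType) (X : Type) (to : gaction G X) g :
  cancel (to g) (to g^-1%g).
Proof. by move=> x; rewrite -gactM mulVg gact1. Qed.

Lemma gactKV (G : groupType) (X : Type) (to : gaction G X) g :
  cancel (to g^-1%g) (to g).
Proof. by move=> x; rewrite -gactM mulgV gact1. Qed.

Section PermutationRepresentation.
Variables (G : groupType) (X : choiceType) (to : gaction G X).

Let perm_fun_subproof g (f : l2 X R[i]) :
  (fun x => f (to g^-1%g x)) \in @sqsummable_pred R X R[i].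
Proof.
have [M fM] := l2P f; apply/asboolP; exists M => A.
rewrite (big_fset_reindex (fun x => `|f x| ^+ 2) _ (gactKV to g) (gactK to g)).
exact: fM.
Qed.
Definition perm_fun g (f : l2 X R[i]) : l2 X R[i] := L2 (perm_fun_subproof g f).

Let perm_fun_inner g f1 f2 :
  inner (perm_fun g f1) (perm_fun g f2) = inner f1 f2.
Proof.
exact: (sum_reindex (gactKV to g) (gactK to g) (@l2_inner_cvg _ _ _ f1 f2)).
Qed.

Let perm_bop_subproof g : perm_fun g \in @bop_pred R (l2 X R[i]).
Proof.
apply/asboolP; split=> [a f1 f2|]; first exact: val_inj.
by exists 1 => f; rewrite mul1r !normr_inner perm_fun_inner.
Qed.
Definition perm_bop g : bop (l2 X R[i]) := Bop (perm_bop_subproof g).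

Let perm_bop1 : perm_bop 1%g = 1.
Proof.
apply: bop_eqP => f; apply/val_inj/funext => x /=.
by rewrite invg1 gact1.
Qed.
Let perm_bopM g h : perm_bop (g * h)%g = perm_bop g * perm_bop h.
Proof.
apply: bop_eqP => f; apply/val_inj/funext => x /=.
by rewrite invgM gactM.
Qed.
Definition perm_rep : unirep G (l2 X R[i]) :=
  @Unirep _ _ perm_bop perm_bop1 perm_bopM perm_fun_inner.

Definition has_spectral_gap : Prop :=
  ~ weakly_contained (trivial_rep G) perm_rep.

End PermutationRepresentation.

Definition irreducible (G : groupType) (V : hilbertType R) (pi : unirep G V) : Prop :=
  (exists u : V, u != 0) /\
  forall W : set V, GRing.submod_closed (mem W) -> closed W ->
    (forall g u, W u -> W (pi g u)) -> W = [set 0] \/ W = setT.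

Definition finite_dimensional (V : hilbertType R) : Prop :=
  exists n (b : 'I_n -> V), forall v, exists c : 'I_n -> R[i],
    v = \sum_i c i *: b i.

Definition linear_span (V : lmodType R[i]) (A : set V) : set V :=
  [set v | exists n (c : 'I_n -> R[i]) (a : 'I_n -> V),
    (forall i, A (a i)) /\ v = \sum_i c i *: a i].

(* The span is already closed under products and adjoints, being spanned by a group
   of unitaries. *)
Definition rep_cstar (G : groupType) (V : hilbertType R) (pi : unirep G V) :
    set (bop V) :=
  closure (linear_span (range pi)).

Definition closed_ideal (V : hilbertType R) (A I : set (bop V)) : Prop :=
  [/\ I `<=` A, closed I, GRing.submod_closed (mem I) &
      forall S T, A S -> I T -> I (S * T) /\ I (T * S)].

Definition smallest_nonzero_ideal (V : hilbertType R) (A I : set (bop V)) : Prop :=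
  [/\ closed_ideal A I, (exists2 T, I T & T != 0) &
      forall J, closed_ideal A J -> (exists2 T, J T & T != 0) -> I `<=` J].

End UnitaryRepresentations.

Local Open Scope quotient_scope.

Section Subgroups.
Variables (G : groupType) (H : groupClosed G).

Definition subgroup_of := {x : G | x \in H}.
HB.instance Definition _ := SubChoice.on subgroup_of.
Let subgroup_group_closed : group_closed (fun x => x \in H).
Proof. by split; [exact: gpred1|exact: gpredF]. Qed.
HB.instance Definition _ :=
  SubChoice_isSubGroup.Build G (fun x => x \in H) subgroup_of subgroup_group_closed.

Definition lcoset_rel (x y : G) : bool := (x^-1 * y)%g \in H.

Let lcoset_refl : reflexive lcoset_rel.
Proof. by move=> x; rewrite /lcoset_rel mulVg gpred1. Qed.
Let lcoset_sym : symmetric lcoset_rel.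
Proof. by move=> x y; rewrite /lcoset_rel -gpredV invgM invgK. Qed.
Let lcoset_trans : transitive lcoset_rel.
Proof.
move=> y x z xy yz; rewrite /lcoset_rel -(mulVKg y z) mulgA.
exact: gpredM.
Qed.
Canonical lcoset_equiv := EquivRel lcoset_rel lcoset_refl lcoset_sym lcoset_trans.

Definition lcosets := {eq_quot lcoset_rel}.
HB.instance Definition _ := Choice.on lcosets.
HB.instance Definition _ := EqQuotient.on lcosets.

Lemma lcosetP x y : reflect (\pi_lcosets x = \pi_lcosets y) ((x^-1 * y)%g \in H).
Proof. exact: (@eqmodP _ lcoset_equiv). Qed.

Lemma lcoset_reprV (x : G) : ((repr (\pi_lcosets x))^-1 * x)%g \in H.
Proof. by apply/lcosetP; rewrite reprK. Qed.

Definition lcosets_fun (g : G) (x : lcosets) : lcosets :=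
  \pi_lcosets (g * repr x)%g.

Lemma lcosets_fun_pi g x :
  lcosets_fun g (\pi_lcosets x) = \pi_lcosets (g * x)%g.
Proof.
apply/lcosetP; rewrite invgM -mulgA mulKg.
exact: lcoset_reprV.
Qed.

Let lcosets_fun1 x : lcosets_fun 1%g x = x.
Proof. by rewrite /lcosets_fun mul1g reprK. Qed.
Let lcosets_funM g h x : lcosets_fun (g * h)%g x = lcosets_fun g (lcosets_fun h x).
Proof. by rewrite -[lcosets_fun h x]/(\pi_lcosets _) lcosets_fun_pi mulgA. Qed.
Definition lcosets_action : gaction G lcosets := Gaction lcosets_fun1 lcosets_funM.

Definition punctured_lcosets := {x : lcosets | x != \pi_lcosets 1%g}.
HB.instance Definition _ := SubChoice.on punctured_lcosets.

Let punctured_subproof (h : subgroup_of) (x : punctured_lcosets) :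
  lcosets_action (val h) (val x) != \pi_lcosets 1%g.
Proof.
apply: contra (valP x) => /eqP e.
rewrite -(gactK lcosets_action (val h) (val x)) e /= lcosets_fun_pi mulg1.
by apply/eqP/esym/lcosetP; rewrite invg1 mul1g gpredV (valP h).
Qed.
Definition punctured_fun (h : subgroup_of) (x : punctured_lcosets) :
  punctured_lcosets := @exist lcosets (fun y => y != \pi_lcosets 1%g) _ (punctured_subproof h x).

Let punctured_fun1 x : punctured_fun 1%g x = x.
Proof. by apply/val_inj; exact: (gact1 lcosets_action). Qed.
Let punctured_funM g h x :
  punctured_fun (g * h)%g x = punctured_fun g (punctured_fun h x).
Proof. by apply/val_inj; exact: (gactM lcosets_action). Qed.
Definition punctured_action : gaction subgroup_of punctured_lcosets :=
  Gaction punctured_fun1 punctured_funM.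

End Subgroups.

Definition spectral_gap_property (R : realType) (G : groupType)
    (H : groupClosed G) : Prop :=
  has_spectral_gap R (punctured_action H).

(* The induced representation: functions on `G` with values in the space of `sigma`
   such that `f (g h) = sigma(h)^-1 (f g)` for `h` in `H`, with `|f|` square-summable on
   `G / H`, on which `G` acts by left translation. As `sigma` is unitary, `|f|` and
   the inner products of two such functions are constant on left cosets, so the
   choice of the representatives `repr x` is irrelevant. *)
Section InducedRepresentation.
Variables (R : realType) (G : groupType) (H : groupClosed G) (V : hilbertType R).
Variable sigma : unirep (subgroup_of H) V.

Definition ind_pred : {pred G -> V} := fun f =>
  `[< (forall g (h : subgroup_of H), f (g * val h)%g = sigma h^-1%g (f g)) /\
      sqsummable (fun x : lcosets H => f (repr x)) >].

Lemma ind_submod : GRing.submod_closed ind_pred.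
Proof.
split=> [|a f1 f2 /asboolP[f1e f1s] /asboolP[f2e f2s]]; apply/asboolP.
  split=> [g h|]; first by rewrite linear0.
  by have [/asboolP] := @sqsummable_submod R (lcosets H) V.
split=> [g h|].
  rewrite -![(a *: f1 + f2) _]/(a *: f1 _ + f2 _).
  by rewrite f1e f2e linearP.
have [_ sZD] := @sqsummable_submod R (lcosets H) V.
have /asboolP := sZD a _ _ (asboolT f1s) (asboolT f2s).
by [].
Qed.

Record ind_space : Type := IndSpace {
  ind_fun :> G -> V;
  ind_proof : ind_fun \in ind_pred }.

HB.instance Definition _ := [isSub for ind_fun].
HB.instance Definition _ := [Choice of ind_space by <:].
HB.instance Definition _ :=
  GRing.SubChoice_isSubLmodule.Build _ _ _ ind_space ind_submod.

Lemma ind_equivariant (f : ind_space) g (h : subgroup_of H) :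
  f (g * val h)%g = sigma h^-1%g (f g).
Proof. by have /asboolP[fe _] := ind_proof f; exact: fe. Qed.

Lemma ind_l2_subproof (f : ind_space) :
  (fun x : lcosets H => f (repr x)) \in @sqsummable_pred R (lcosets H) V.
Proof. by have /asboolP[_ fs] := ind_proof f; exact/asboolP. Qed.
Definition ind_l2 (f : ind_space) : l2 (lcosets H) V := L2 (ind_l2_subproof f).

Lemma ind_l2_linear : linear ind_l2.
Proof. by move=> a f1 f2; apply/val_inj. Qed.
HB.instance Definition _ := GRing.isLinear.Build _ _ _ _ ind_l2 ind_l2_linear.

Let lcoset_part (g : G) : subgroup_of H := @exist G (fun x => x \in H) _ (lcoset_reprV H g).

Let lcoset_partE g : (repr (\pi_(lcosets H) g) * val (lcoset_part g))%g = g.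
Proof. by rewrite /= mulVKg. Qed.

Lemma ind_l2_inj : injective ind_l2.
Proof.
move=> f1 f2 e; apply/val_inj/funext => g /=.
rewrite -(lcoset_partE g) !ind_equivariant; congr (sigma _ _).
by have /(congr1 val)/funeqP/(_ (\pi_(lcosets H) g)) := e.
Qed.

Lemma ind_l2_surj (f : l2 (lcosets H) V) : exists f' : ind_space, ind_l2 f' = f.
Proof.
pose f' g := sigma (lcoset_part g)^-1%g (f (\pi_(lcosets H) g)).
have pi_mulr g (h : subgroup_of H) : \pi_(lcosets H) (g * val h)%g = \pi_(lcosets H) g.
  by apply/esym/lcosetP; rewrite mulKg (valP h).
have f'r x : f' (repr x) = f x.
  rewrite /f' reprK.
  suff -> : lcoset_part (repr x) = 1%g by rewrite invg1 unirep1.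
  by apply/val_inj; rewrite /= reprK mulVg.
have f'P : f' \in ind_pred.
  apply/asboolP; split=> [g h|]; last first.
    by rewrite (_ : (fun x => _) = f) ?funeqE//; exact: l2P.
  rewrite /f' pi_mulr -[RHS]/((sigma h^-1%g * sigma (lcoset_part g)^-1%g) _) -unirepM.
  rewrite -invgM; congr (sigma _^-1%g _); apply/val_inj.
  by rewrite /= pi_mulr mulgA.
by exists (IndSpace f'P); apply/val_inj/funext.
Qed.

Definition ind_inner (f1 f2 : ind_space) : R[i] :=
  summability.sum (fun x : lcosets H => inner (f1 (repr x)) (f2 (repr x))).

Lemma ind_innerE f1 f2 : ind_inner f1 f2 = inner (ind_l2 f1) (ind_l2 f2).
Proof. by []. Qed.

Let ind_inner_linear f : scalar (ind_inner^~ f).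
Proof. by move=> a u v; rewrite !ind_innerE linearP linearDl linearZl_LR. Qed.
Let ind_inner_conj f1 f2 : ind_inner f1 f2 = (ind_inner f2 f1)^*.
Proof. by rewrite !ind_innerE (hermC inner) expr0 mul1r. Qed.
Let ind_inner_gt0 f : f != 0 -> 0 < ind_inner f f.
Proof.
move=> f0; rewrite ind_innerE dnorm_gt0; apply: contra f0 => /eqP e.
by apply/eqP/ind_l2_inj; rewrite e linear0.
Qed.
HB.instance Definition _ := isInnerProduct.Build _ _ ind_inner
  ind_inner_linear ind_inner_conj ind_inner_gt0.

HB.instance Definition _ := Lmodule_isNormed.Build R[i] ind_space
  (ler_dot_normD ind_inner) (dot_normZ ind_inner) (@dot_norm0_eq0 _ _ ind_inner).

Lemma ind_normE (f : ind_space) : `|f| = sqrtC (ind_inner f f).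
Proof. by []. Qed.

Lemma ind_l2_norm (f : ind_space) : `|ind_l2 f| = `|f|.
Proof. by rewrite normr_inner ind_normE ind_innerE. Qed.

Let ind_complete (F : set_system ind_space) : ProperFilter F -> cauchy F -> cvg F.
Proof.
move=> FF Fc.
have /cauchy_cvgP/cvg_ex[l Fl] : cauchy (ind_l2 @ F).
  apply/cauchy_exP => e e0; have /cauchyP/(_ _ e0)[f Ff] := Fc.
  exists (ind_l2 f); rewrite /fmap/=; apply: filterS Ff => g.
  by rewrite -!ball_normE /= -linearB ind_l2_norm.
have [f fl] := ind_l2_surj l; apply/cvg_ex; exists f.
apply/cvgrPdist_lt => e e0.
have /cvgrPdist_lt/(_ _ e0) := Fl; apply: filterS => g.
by rewrite -fl -linearB ind_l2_norm.
Qed.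
HB.instance Definition _ := Uniform_isComplete.Build ind_space ind_complete.
HB.instance Definition _ := isHilbert.Build R ind_space ind_normE.

Lemma ind_translate_repr (f : ind_space) g (x : lcosets H) :
  exists h, f (g^-1 * repr x)%g = sigma h (f (repr (lcosets_action H g^-1%g x))).
Proof.
exists (lcoset_part (g^-1 * repr x))^-1%g.
by rewrite -[in LHS](lcoset_partE (g^-1 * repr x)) ind_equivariant.
Qed.

Let ind_translate_subproof g (f : ind_space) :
  (fun y => f (g^-1 * y)%g) \in ind_pred.
Proof.
apply/asboolP; split=> [y h|]; first by rewrite mulgA ind_equivariant.
have [M fM] := l2P (ind_l2 f); exists M => A.
rewrite (eq_bigr (fun x => `|ind_l2 f (lcosets_action H g^-1%g x)| ^+ 2)).
  rewrite (big_fset_reindex (fun x => `|ind_l2 f x| ^+ 2) _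
    (gactKV (lcosets_action H) g) (gactK (lcosets_action H) g)).
  exact: fM.
by move=> x _; have [h ->] := ind_translate_repr f g x; rewrite unirep_norm.
Qed.
Definition ind_translate g (f : ind_space) : ind_space :=
  IndSpace (ind_translate_subproof g f).

Let ind_translate_inner g f1 f2 :
  inner (ind_translate g f1) (ind_translate g f2) = inner f1 f2.
Proof.
rewrite -[RHS](sum_reindex (gactKV (lcosets_action H) g)
  (gactK (lcosets_action H) g) (@l2_inner_cvg _ _ _ (ind_l2 f1) (ind_l2 f2))).
congr (summability.sum _); apply/funext => x /=.
have e (f : ind_space) : f (g^-1 * repr x)%g =
    sigma (lcoset_part (g^-1 * repr x))^-1%g (f (repr (lcosets_action H g^-1%g x))).
  by rewrite -[in LHS](lcoset_partE (g^-1 * repr x)) ind_equivariant.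
by rewrite !e unirep_unitary.
Qed.

Let ind_bop_subproof g : ind_translate g \in @bop_pred R ind_space.
Proof.
apply/asboolP; split=> [a f1 f2|]; first exact: val_inj.
by exists 1 => f; rewrite mul1r !normr_inner ind_translate_inner.
Qed.
Definition ind_bop g : bop ind_space := Bop (ind_bop_subproof g).

Let ind_bop1 : ind_bop 1%g = 1.
Proof.
apply: bop_eqP => f; apply/val_inj/funext => x /=.
by rewrite invg1 mul1g.
Qed.
Let ind_bopM g h : ind_bop (g * h)%g = ind_bop g * ind_bop h.
Proof.
apply: bop_eqP => f; apply/val_inj/funext => x /=.
by rewrite invgM mulgA.
Qed.

Definition ind_rep : unirep G ind_space :=
  @Unirep _ _ _ ind_bop ind_bop1 ind_bopM ind_translate_inner.

End InducedRepresentation.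

(* Main.v *)
Require Import Defs.
From HB Require Import structures.
From mathcomp Require Import all_boot all_order all_algebra finmap.
From mathcomp Require Import sesquilinear complex ring generic_quotient.
From mathcomp Require Import all_classical all_reals.
From mathcomp Require Import topology normedtype sequences.
From mathcomp.analysis.showcase Require Import summability.
Set Implicit Arguments.
Unset Strict Implicit.
Unset Printing Implicit Defensive.
Import Order.TTheory GRing.Theory Num.Theory.
Import numFieldNormedType.Exports.
Local Open Scope classical_set_scope.
Local Open Scope ring_scope.
Local Open Scope quotient_scope.

(** Let [W] be the space of the induced representation [pi], let [A] be the algebra that
    [pi] generates, and let [iota : V -> W] be the embedding of the space of [sigma] as
    the functions supported on [H].  The theorem rests on the fact that [A] contains
    every rank-one operator between vectors of the image of [iota]
    ([rank_one_rep_cstar]).  Granting it, let [J] be a non-zero closed ideal and [T] a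
    non-zero element of [J].  The translates of the image of [iota] span a dense
    subspace ([bop_ind_eq0]), hence [T] has a non-zero matrix coefficient between two
    translated vectors of this image.  Multiplying [T] by translations and rank-one
    operators on both sides yields a fixed rank-one operator in [J]
    ([rank_one_ideal]).  So the intersection of all non-zero closed ideals is non-zero,
    and it is the smallest one.

    To find the rank-one operators, let [H] act by conjugation on the linear maps from
    [V] to [W], with the Hilbert-Schmidt norm.  This action is isometric and fixes
    [iota].  It has a gap on the orthocomplement of [iota]: finitely many [h] in [H]
    satisfy [|T|^2 <= c * sum_h |h T - T|^2] there ([induced_gap]).  For maps into
    the functions vanishing on [H], this is the spectral gap of [H] on the
    punctured coset space, applied to the pointwise norm of [T] ([punctured_gap]).
    For maps into the functions supported on [H], that is, endomorphisms of [V], it is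
    Schur's lemma together with finite dimension ([irreducible_gap]).

    Given the gap, an average of the operators [(1 + h) / 2] is a strict contraction
    on the orthocomplement of [iota], so its powers converge in norm to the projection
    on [iota] ([average_iter_cvg]).  Apply them to the map sending a basis vector [e j]
    to [f] and the other basis vectors to 0.  The value at [e l] of the result is [B f]
    with [B] a combination of the [pi h], and in the limit it is
    [<f, iota (e j)> iota (e l)] divided by the dimension of [V].  The convergence is
    uniform in [f] in the unit ball, so this rank-one operator is in the closure [A]. *)

(** * Spaces with an inner product *)

Section DotForm.
Variables (C : numClosedFieldType) (E : lmodType C).
Variable form : {dot E for Num.Def.conjC}.
Implicit Types (u v w : E) (Q : {pred E}).

Lemma dot_conj u v : form u v = (form v u)^*.
Proof. by rewrite (hermC form) expr0 mul1r. Qed.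

Lemma dot_nondegenerate u v : (forall w, form w u = form w v) -> u = v.
Proof.
move=> uv; apply/eqP; rewrite -subr_eq0 -(dnorm_eq0 form).
by rewrite linearBr /= uv subrr.
Qed.

Lemma dnormD_le u v : form (u + v) (u + v) <= form u u *+ 2 + form v v *+ 2.
Proof.
rewrite -subr_ge0.
have -> : form u u *+ 2 + form v v *+ 2 - form (u + v) (u + v) =
  form (u - v) (u - v) by rewrite dnormB dnormD; ring.
exact: dnorm_ge0.
Qed.

Lemma dot_CauchySchwarz_sqr u v : `|form u v| ^+ 2 <= form u u * form v v.
Proof.
rewrite -!dot_norm_sqr -exprMn ler_sqr ?nnegrE ?mulr_ge0 ?dot_norm_ge0//.
exact: dot_CauchySchwarz.
Qed.

Definition is_orthonormal (n : nat) (e : 'I_n -> E) :=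
  forall i j, form (e i) (e j) = (i == j)%:R.

Definition expands_on (n : nat) (e : 'I_n -> E) (Q : {pred E}) :=
  forall u, u \in Q -> u = \sum_i form u (e i) *: e i.

Lemma orthonormal_coord n (e : 'I_n -> E) (c : 'I_n -> C) j :
  is_orthonormal e -> form (\sum_i c i *: e i) (e j) = c j.
Proof.
move=> eo; rewrite linear_sumlz (bigD1 j)//= linearZl_LR /= eo eqxx mulr1.
by rewrite big1 ?addr0// => i ij; rewrite linearZl_LR /= eo (negbTE ij) mulr0.
Qed.

(** The Gram matrix of an orthonormal family is the identity matrix, and it factors
    through the coordinates on any spanning family. *)
Lemma orthonormal_size_le n (e : 'I_n -> E) (I : finType) (b : I -> E) :
  (forall u, exists c : I -> C, u = \sum_i c i *: b i) ->
  is_orthonormal e -> (n <= #|I|)%N.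
Proof.
move=> span eo; have /choice[c ec] : forall k, exists c : I -> C,
  e k = \sum_i c i *: b i by move=> k; exact: span.
pose A := \matrix_(k < n, i < #|I|) c k (enum_val i).
pose B := \matrix_(i < #|I|, k < n) form (b (enum_val i)) (e k).
apply: (@mulmx1_min _ _ _ A B); apply/matrixP => k l; rewrite !mxE -eo.
rewrite {1}ec linear_sumlz (reindex _ (onW_bij _ (enum_val_bij I))) /=.
by apply: eq_bigr => i _; rewrite !mxE linearZl_LR.
Qed.

(** A maximal orthonormal family of the subspace [Q] is a basis of it: the difference
    between a vector of [Q] and its projection could otherwise be normalised and
    added to the family. *)
Lemma orthonormal_basis (I : finType) (b : I -> E) Q :
  (forall u, exists c : I -> C, u = \sum_i c i *: b i) ->
  GRing.submod_closed Q ->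
  exists n (e : 'I_n -> E),
    [/\ forall i, e i \in Q, is_orthonormal e & expands_on e Q].
Proof.
move=> span Qs.
have Qsum n (f : 'I_n -> E) : (forall i, f i \in Q) -> \sum_i f i \in Q.
  case: Qs => Q0 QD fQ; elim/big_ind: _ => // u v uQ vQ.
  by rewrite -[u]scale1r QD.
have QZ a u : u \in Q -> a *: u \in Q.
  by case: Qs => Q0 QD uQ; rewrite -[a *: u]addr0 QD.
pose P n := `[< exists e : 'I_n -> E, (forall i, e i \in Q) /\ is_orthonormal e >].
have P0 : exists n, P n.
  by exists 0%N; apply/asboolP; exists (fun=> 0); split => [[]|[]].
have Pb n : P n -> (n <= #|I|)%N.
  by move=> /asboolP[e [_ eo]]; exact: orthonormal_size_le eo.
case: (ex_maxnP P0 Pb) => n /asboolP[e [eQ eo]] nmax; exists n, e; split=> // u uQ.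
apply/eqP; rewrite -subr_eq0; apply: contraT => r0.
set r := u - _ in r0.
have rQ : r \in Q.
  rewrite /r addrC -scaleN1r; case: (Qs) => _ -> //.
  by apply: Qsum => i; exact: QZ.
have re i : form r (e i) = 0.
  by rewrite /r linearBl /= orthonormal_coord ?subrr.
have er i : form (e i) r = 0 by rewrite dot_conj re conjC0.
pose q := (dot_norm form r)^-1 *: r.
have qq : form q q = 1.
  rewrite dnormZ -dot_norm_sqr -exprMn normfV ger0_norm ?dot_norm_ge0//.
  by rewrite mulVf ?expr1n// /dot_norm sqrt_dnorm_eq0.
have qe i : form q (e i) = 0 by rewrite linearZl_LR /= re mulr0.
have eq i : form (e i) q = 0 by rewrite dot_conj qe conjC0.
suff : P n.+1 by move/nmax; rewrite ltnn.
apply/asboolP; exists (fun i => if unlift ord0 i is Some j then e j else q).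
split=> [i|i j]; first by case: unliftP => [j _|_] //; exact: QZ.
case: (unliftP ord0 i) (unliftP ord0 j) => [i' ->|->] [j' ->|->];
  by rewrite ?qe ?eq ?qq ?eqxx// eo (inj_eq (@lift_inj _ _)).
Qed.

(** A vector differs from its projection on an orthonormal basis of [Q] by a vector
    orthogonal to [Q]. *)
Lemma trivial_orthocomplement (I : finType) (b : I -> E) Q :
  (forall u, exists c : I -> C, u = \sum_i c i *: b i) ->
  GRing.submod_closed Q ->
  (forall u, (forall q, q \in Q -> form u q = 0) -> u = 0) -> forall u, u \in Q.
Proof.
move=> span Qs Qo u; have [n [e [eQ eo eb]]] := orthonormal_basis span Qs.
have Qsum m (f : 'I_m -> E) : (forall i, f i \in Q) -> \sum_i f i \in Q.
  case: Qs => Q0 QD fQ; elim/big_ind: _ => // v w vQ wQ.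
  by rewrite -[v]scale1r QD.
suff /eqP : u - \sum_i form u (e i) *: e i = 0.
  rewrite subr_eq0 => /eqP ->; apply: Qsum => i.
  by case: Qs => Q0 QD; rewrite -[_ *: _]addr0 QD.
apply: Qo => q /eb ->; rewrite linear_sumr big1// => i _.
by rewrite linearZr_LR /= linearBl /= orthonormal_coord ?subrr ?mulr0.
Qed.

End DotForm.

(** * Tuples of vectors and the conjugation action on them *)

Section HilbertSchmidt.
Variables (R : realType) (n : nat) (W : hilbertType R).

(** A tuple [T : 'I_n -> W] stands for the linear map sending the [j]-th vector of an
    orthonormal basis to [T j]; this form is then the Hilbert-Schmidt one. *)
Definition hs_inner (T S : 'I_n -> W) : R[i] := \sum_j inner (T j) (S j).

Let hs_inner_linear S : scalar (hs_inner^~ S).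
Proof.
move=> a u v; rewrite /hs_inner mulr_sumr -big_split/=.
by apply: eq_bigr => j _; rewrite linearDl linearZl_LR.
Qed.
Let hs_inner_conj T S : hs_inner T S = (hs_inner S T)^*.
Proof. by rewrite rmorph_sum; apply: eq_bigr => j _ /=; exact: dot_conj. Qed.
Let hs_inner_gt0 T : T != 0 -> 0 < hs_inner T T.
Proof.
move=> T0; have [j Tj] : exists j, T j != 0.
  apply: contrapT => Tj; move/eqP: T0; apply; apply/funext => j.
  by apply: contrapT => /eqP Tj0; apply: Tj; exists j.
rewrite /hs_inner (bigD1 j)//= ltr_pwDl ?dnorm_gt0//.
by apply: sumr_ge0 => i _; exact: dnorm_ge0.
Qed.
HB.instance Definition _ := isInnerProduct.Build _ _ hs_inner
  hs_inner_linear hs_inner_conj hs_inner_gt0.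

Lemma hs_inner_sqr T : hs_inner T T = \sum_j `|T j| ^+ 2.
Proof. by apply: eq_bigr => j _; rewrite normr_inner_sqr. Qed.

End HilbertSchmidt.

Section Parseval.
Variables (R : realType) (V : hilbertType R) (n : nat) (e : 'I_n -> V).
Hypothesis eb : expands_on inner e predT.

Lemma parseval (u v : V) :
  inner u v = \sum_i inner u (e i) * inner (e i) v.
Proof.
rewrite {1}(eb (u := u))// linear_sumlz; apply: eq_bigr => i _.
by rewrite linearZl_LR.
Qed.

End Parseval.

Section HomAction.
Variables (R : realType) (H : groupType) (V : hilbertType R) (sigma : unirep H V).
Variables (n : nat) (e : 'I_n -> V).
Hypotheses (eo : is_orthonormal inner e) (eb : expands_on inner e predT).

Lemma unirep_adjoint (W : hilbertType R) (pi : unirep H W) h u v :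
  inner (pi h u) v = inner u (pi h^-1%g v).
Proof. by rewrite -(unirep_unitary pi h^-1%g) unirepK. Qed.

Lemma unirepKV (W : hilbertType R) (pi : unirep H W) h :
  cancel (pi h^-1%g) (pi h).
Proof. by move=> u; rewrite -{1}[h]invgK unirepK. Qed.

(** Precomposition with [sigma h^-1] of the linear map that the tuple stands for. *)
Definition hom_mix (W : lmodType R[i]) (h : H) (T : 'I_n -> W) : 'I_n -> W :=
  fun j => \sum_i inner (sigma h^-1%g (e j)) (e i) *: T i.

(** The conjugation action of [H] on linear maps from [V] to [W]: in terms of the maps,
    [h] sends [T] to [pi h \o T \o sigma h^-1]. *)
Definition hom_act (W : hilbertType R) (pi : unirep H W) h (T : 'I_n -> W) :=
  hom_mix h (fun i => pi h (T i)).

(** The matrix of a unitary operator in an orthonormal basis is unitary. *)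
Lemma unirep_matrix_unitary h i k :
  \sum_j inner (sigma h (e j)) (e i) * (inner (sigma h (e j)) (e k))^* =
  (i == k)%:R.
Proof.
rewrite eq_sym -eo -(unirep_unitary sigma h^-1%g) (parseval eb).
apply: eq_bigr => j _; rewrite [inner _ (e j)]dot_conj -!unirep_adjoint.
exact: mulrC.
Qed.

Lemma hom_mix_isometry (W : hilbertType R) h (T S : 'I_n -> W) :
  hs_inner (hom_mix h T) (hom_mix h S) = hs_inner T S.
Proof.
pose c j i := inner (sigma h^-1%g (e j)) (e i).
transitivity (\sum_i \sum_k (\sum_j c j i * (c j k)^*) * inner (T i) (S k)).
  rewrite /hs_inner /hom_mix.
  under [RHS]eq_bigr => i _.
    under eq_bigr do rewrite mulr_suml.
    rewrite exchange_big /=; over.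
  rewrite exchange_big; apply: eq_bigr => j _ /=.
  rewrite linear_sumlz; apply: eq_bigr => i _; rewrite linear_sumr.
  by apply: eq_bigr => k _; rewrite linearZr_LR /= linearZl_LR /= mulrCA mulrA.
apply: eq_bigr => i _; rewrite (bigD1 i)//= unirep_matrix_unitary eqxx mul1r.
by rewrite big1 ?addr0// => k ki; rewrite unirep_matrix_unitary eq_sym (negbTE ki) mul0r.
Qed.

Lemma hom_act_isometry (W : hilbertType R) (pi : unirep H W) h T S :
  hs_inner (hom_act pi h T) (hom_act pi h S) = hs_inner T S.
Proof.
rewrite hom_mix_isometry; apply: eq_bigr => j _; exact: unirep_unitary.
Qed.

Lemma hom_act_adjoint (W : hilbertType R) (pi : unirep H W) h T S :
  hs_inner (hom_act pi h T) S = hs_inner T (hom_act pi h^-1%g S).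
Proof.
rewrite /hs_inner /hom_act /hom_mix.
under eq_bigr do rewrite linear_sumlz.
under [RHS]eq_bigr do rewrite linear_sumr.
rewrite exchange_big /=; apply: eq_bigr => i _; apply: eq_bigr => j _.
rewrite linearZl_LR linearZr_LR /= (unirep_adjoint pi) -dot_conj.
by rewrite (unirep_adjoint sigma).
Qed.

Lemma hom_act_linear (W : hilbertType R) (pi : unirep H W) h :
  linear (hom_act pi h).
Proof.
move=> a T S; apply/funext => j; rewrite /hom_act /hom_mix.
rewrite -![(_ + _) j]/(a *: _ + _) scaler_sumr -big_split; apply: eq_bigr => i _ /=.
by rewrite -![(a *: T + S) i]/(a *: T i + S i) linearP scalerDr !scalerA mulrC.
Qed.
HB.instance Definition _ (W : hilbertType R) (pi : unirep H W) h :=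
  GRing.isLinear.Build _ _ _ _ (hom_act pi h) (hom_act_linear pi h).

Section Intertwiner.
Variables (W W' : hilbertType R) (pi : unirep H W) (pi' : unirep H W').
Variable A : {linear W -> W'}.
Hypothesis Api : forall h u, A (pi h u) = pi' h (A u).

Lemma hom_act_natural h T : A \o hom_act pi h T = hom_act pi' h (A \o T).
Proof.
apply/funext => j; rewrite /= /hom_act /hom_mix linear_sum /=.
by apply: eq_bigr => i _; rewrite linearZ /= Api.
Qed.
End Intertwiner.

(** How far [T] is from being fixed by the elements of [s]; all the almost-invariance
    arguments below are phrased as upper bounds of a norm by this quantity. *)
Definition displacement (W : hilbertType R) (pi : unirep H W) (s : seq H)
    (T : 'I_n -> W) : R[i] :=
  \sum_(h <- s) hs_inner (hom_act pi h T - T) (hom_act pi h T - T).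

Lemma displacement_ge0 (W : hilbertType R) (pi : unirep H W) s T :
  0 <= displacement pi s T.
Proof. by apply: sumr_ge0 => h _; exact: dnorm_ge0. Qed.

Lemma displacement_cat (W : hilbertType R) (pi : unirep H W) s1 s2 T :
  displacement pi (s1 ++ s2) T = displacement pi s1 T + displacement pi s2 T.
Proof. exact: big_cat. Qed.

Lemma hom_act_intertwiner (W : hilbertType R) (pi : unirep H W)
    (A : {linear V -> W}) h : (forall h v, A (sigma h v) = pi h (A v)) ->
  hom_act pi h (A \o e) = A \o e.
Proof.
move=> Api; apply/funext => j; rewrite /= /hom_act /hom_mix.
under eq_bigr do rewrite /= -Api -!linearZ /=.
by rewrite -!linear_sum /= -(eb (u := sigma h^-1%g (e j)))// unirepKV.
Qed.

End HomAction.

(** * Irreducibility *)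

Section RankOne.
Variables (R : realType) (W : hilbertType R).

Lemma sqr_normD_le (u v : W) : `|u + v| ^+ 2 <= `|u| ^+ 2 *+ 2 + `|v| ^+ 2 *+ 2.
Proof. by rewrite !normr_inner_sqr; exact: dnormD_le. Qed.

Lemma bop_sumE (I : Type) (s : seq I) (P : pred I) (T : I -> bop W) u :
  (\sum_(i <- s | P i) T i) u = \sum_(i <- s | P i) T i u.
Proof. by elim/big_rec2: _ => // i S v _ <-. Qed.

Let rank_one_subproof (u v : W) : (fun w => inner w v *: u) \in @bop_pred R W.
Proof.
apply/asboolP; split=> [a w w'|].
  by rewrite linearDl linearZl_LR scalerDl scalerA.
exists (`|v| * `|u|) => w; rewrite normrZ mulrAC ler_wpM2r// mulrC.
by apply: le_trans (dot_CauchySchwarz _ _ _) _; rewrite /dot_norm -!normr_inner.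
Qed.
Definition rank_one (u v : W) : bop W := Bop (rank_one_subproof u v).

Lemma rank_oneE u v w : rank_one u v w = inner w v *: u.
Proof. by []. Qed.

Lemma bop_continuous (T : bop W) : continuous T.
Proof.
move=> u; have [M M0 TM] := bop_bounded T.
apply/cvgrPdist_lt => e e0; near=> v.
rewrite -linearB; apply: le_lt_trans (TM _) _.
apply: le_lt_trans (_ : _ <= (M%:C%C + 1) * `|u - v|) _.
  by rewrite ler_wpM2r// lerDl.
rewrite mulrC -ltr_pdivlMr ?ltr_wpDl ?ler0c//; near: v.
apply: (@cvgr_dist_lt _ _ _ _ _ id) => //.
by rewrite divr_gt0// ltr_wpDl ?ler0c.
Unshelve. all: by end_near. Qed.

Lemma bop_kernel_closed (T : bop W) : closed [set u | T u = 0].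
Proof.
have c0 : closed [set 0 : W].
  by apply: accessible_closed_set1; apply: hausdorff_accessible; exact: norm_hausdorff.
by apply: closed_comp c0 => u _; exact: bop_continuous.
Qed.

End RankOne.

Section Irreducible.
Variables (R : realType) (H : groupType) (V : hilbertType R) (sigma : unirep H V).
Hypothesis sigma_irr : irreducible sigma.
Variables (n : nat) (e : 'I_n -> V).
Hypotheses (eo : is_orthonormal inner e) (eb : expands_on inner e predT).

Lemma basis_nonempty : (0 < n)%N.
Proof.
have [[u u0] _] := sigma_irr.
case: n e eb => // e0 eb0; move: u0; rewrite (eb0 u isT) big_ord0 eqxx//.
Qed.

(** Schur's lemma: an eigenspace of an operator commuting with [sigma] is invariant. *)
Lemma schur (T : bop V) : (forall h u, T (sigma h u) = sigma h (T u)) ->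
  exists a : R[i], forall u, T u = a *: u.
Proof.
move=> Tsigma; pose A := \matrix_(i < n, j < n) inner (T (e i)) (e j).
have [a] : exists a, root (char_poly A) a.
  by apply/closed_rootP; rewrite size_char_poly eqSS -lt0n basis_nonempty.
rewrite -eigenvalue_root_char => /eigenvalueP[x xA x0].
pose u := \sum_i x 0 i *: e i.
have u0 : u != 0.
  apply: contra x0 => /eqP ue; apply/eqP/rowP => j.
  by rewrite mxE -(orthonormal_coord (x 0) j eo) -/u ue linear0l.
have Tu : T u = a *: u.
  rewrite linear_sum /= (eb (u := \sum_i _))// scaler_sumr; apply: eq_bigr => j _.
  rewrite scalerA; congr (_ *: _).
  have /rowP/(_ j) := xA; rewrite !mxE => <-.
  rewrite linear_sumlz; apply: eq_bigr => i _.
  by rewrite linearZ /= linearZl_LR mxE.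
have [K KE] : exists K : bop V, forall v, K v = T v - a *: v.
  by exists (T - a *: (1 : bop V)).
have [_ /(_ [set v | K v = 0])] := sigma_irr; case.
- split=> [|b v w]; rewrite !inE; first exact: linear0.
  by move=> /= v0 w0; rewrite linearP /= v0 w0 scaler0 addr0.
- exact: bop_kernel_closed.
- move=> h v /=; rewrite !KE Tsigma => /eqP; rewrite subr_eq0 => /eqP ->.
  by rewrite linearZ subrr.
- move=> K0; case/eqP: u0.
  suff : [set v | K v = 0] u by rewrite K0.
  by rewrite /= KE Tu subrr.
- move=> KT; exists a => v; apply/eqP; rewrite -subr_eq0 -KE; apply/eqP.
  by have : [set v | K v = 0] v by rewrite KT.
Qed.

(** An invariant tuple stands for a linear map commuting with [sigma], and [e] stands
    for the identity. *)
Lemma hom_act_fixed (S : 'I_n -> V) :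
  (forall h, hom_act sigma e sigma h S = S) -> exists a : R[i], S = a *: e.
Proof.
move=> Sfix.
have [T TE] : exists T : bop V, forall u, T u = \sum_i inner u (e i) *: S i.
  by exists (\sum_i rank_one (S i) (e i)) => u; rewrite bop_sumE.
have Te j : T (e j) = S j.
  rewrite TE (bigD1 j)//= eo eqxx scale1r big1 ?addr0// => i ij.
  by rewrite eo eq_sym (negbTE ij) scale0r.
have Tsigma h u : T (sigma h u) = sigma h (T u).
  rewrite -{2}(unirepK sigma h u) -[RHS]/((sigma h * T * sigma h^-1%g) (sigma h u)).
  rewrite (eb (u := sigma h u))// !linear_sum; apply: eq_bigr => j _ /=.
  rewrite !linearZ /=; congr (_ *: _).
  rewrite Te -{1}(Sfix h) /hom_act /hom_mix -[RHS]/(sigma h (T _)) TE linear_sum.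
  by apply: eq_bigr => i _; rewrite linearZ.
have [a Ta] := schur Tsigma; exists a; apply/funext => j.
by rewrite -Te Ta.
Qed.

Let hs_span (S : 'I_n -> V) : exists c : 'I_n * 'I_n -> R[i],
  S = \sum_ij c ij *: (fun k => (k == ij.1)%:R *: e ij.2).
Proof.
exists (fun ij => inner (S ij.1) (e ij.2)); apply/funext => k.
rewrite (eb (u := S k))// fct_sumE.
rewrite -(pair_bigA _ (fun i j => inner (S i) (e j) *: ((k == i)%:R *: e j))) /=.
rewrite [RHS](bigD1 k)//= [X in _ + X]big1 ?addr0 => [|i ik].
  by apply: eq_bigr => j _; rewrite eqxx scale1r.
by rewrite big1// => j _; rewrite eq_sym (negbTE ik) scale0r scaler0.
Qed.

(** The vectors [u] whose inner product with the tuples orthogonal to [e] is controlled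
    by the displacement under finitely many elements form a subspace.  It contains the
    [h u - u], so a tuple orthogonal to it is invariant, hence scalar by Schur's lemma
    and zero since [e] belongs to the subspace; in finite dimension the subspace is
    then the whole space. *)
Lemma irreducible_gap : exists (s : seq H) (c : R[i]), 0 <= c /\
  forall S : 'I_n -> V, hs_inner S e = 0 ->
    hs_inner S S <= c * displacement sigma e sigma s S.
Proof.
pose bounded (u : 'I_n -> V) (s : seq H) (c : R[i]) := 0 <= c /\
  forall S : 'I_n -> V, hs_inner S e = 0 ->
    `|hs_inner S u| ^+ 2 <= c * displacement sigma e sigma s S.
pose Q : {pred 'I_n -> V} := fun u => `[< exists s c, bounded u s c >].
have Qs : GRing.submod_closed Q.
  split=> [|a u v /asboolP[s [c [c0 us]]] /asboolP[t [d [d0 vt]]]]; apply/asboolP.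
    by exists [::], 0; split=> // S _; rewrite linear0r normr0 expr0n mul0r.
  exists (s ++ t), ((`|a| ^+ 2 * c) *+ 2 + d *+ 2); split=> [|S Se].
    by rewrite addr_ge0 ?mulrn_wge0 ?mulr_ge0 ?exprn_ge0.
  rewrite linearDr; apply: le_trans (sqr_normD_le _ _) _.
  rewrite linearZr_LR /= normrM norm_conjC exprMn displacement_cat mulrDl.
  rewrite !mulrnAl lerD// lerMn2r //=.
    rewrite -[leRHS]mulrA ler_wpM2l ?exprn_ge0//; apply: le_trans (us S Se) _.
    by rewrite ler_wpM2l// lerDl displacement_ge0.
  by apply: le_trans (vt S Se) _; rewrite ler_wpM2l// lerDr displacement_ge0.
have Qe : e \in Q.
  apply/asboolP; exists [::], 0; split=> // S Se.
  by rewrite Se normr0 expr0n mul0r.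
have Qd h u : hom_act sigma e sigma h u - u \in Q.
  apply/asboolP; exists [:: h^-1%g], (hs_inner u u); split=> [|S Se].
    exact: dnorm_ge0.
  rewrite linearBr /= -{1}[h]invgK -hom_act_adjoint -linearBl.
  rewrite /displacement big_seq1 mulrC; exact: dot_CauchySchwarz_sqr.
have Qall : forall u, u \in Q.
  apply: (trivial_orthocomplement (form := @hs_inner R n V) hs_span Qs) => u uQ.
  have [h|a ua] := @hom_act_fixed u.
    apply/eqP; rewrite -subr_eq0; apply/eqP.
    apply: (@dot_nondegenerate _ _ (@hs_inner R n V)) => w.
    rewrite linear0r linearBr /= -{1}[h]invgK -hom_act_adjoint -linearBl.
    by rewrite /= dot_conj uQ ?conjC0// Qd.
  have := uQ _ Qe; rewrite ua linearZl_LR /= => /eqP; rewrite mulf_eq0.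
  case/orP => [/eqP -> |]; first by rewrite scale0r.
  rewrite dnorm_eq0 => /eqP ee.
  have := eo (Ordinal basis_nonempty) (Ordinal basis_nonempty).
  by rewrite eqxx ee -[(0 : 'I_n -> V) _]/0 linear0l => /esym/eqP; rewrite oner_eq0.
have SE (S : 'I_n -> V) : hs_inner S S = \sum_ij
    `|hs_inner S (fun k => (k == ij.1)%:R *: e ij.2 : V)| ^+ 2.
  rewrite -(pair_bigA _ (fun i j =>
    `|hs_inner S (fun k => (k == i)%:R *: e j : V)| ^+ 2)) /=.
  rewrite /hs_inner; apply: eq_bigr => i _; rewrite (parseval eb).
  apply: eq_bigr => j _; rewrite [inner (e j) _]dot_conj -normCK.
  rewrite (bigD1 i)//= eqxx scale1r big1 ?addr0// => k ki.
  by rewrite (negbTE ki) scale0r linear0r.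
have /choice[s /choice[c sc]] ij :
    exists s c, bounded (fun k => (k == ij.1)%:R *: e ij.2) s c.
  by have /asboolP := Qall (fun k => (k == ij.1)%:R *: e ij.2).
exists (flatten [seq s ij | ij <- enum {: 'I_n * 'I_n}]), (\sum_ij c ij).
split=> [|S Se]; first by apply: sumr_ge0 => ij _; case: (sc ij).
rewrite SE mulr_suml; apply: ler_sum => ij _.
have [c0 /(_ S Se)] := sc ij; move/le_trans; apply; rewrite ler_wpM2l//.
rewrite /displacement big_flatten /= big_map big_enum /= (bigD1 ij)//= lerDl.
by apply: sumr_ge0 => kl _; exact: displacement_ge0.
Qed.

End Irreducible.

(** * Averages of isometries *)

Section Average.
Variables (C : numClosedFieldType) (K : lmodType C).
Variable form : {dot K for Num.Def.conjC}.
Variables (I : Type) (U : I -> {linear K -> K}).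
Hypothesis U_isometry : forall i x y, form (U i x) (U i y) = form x y.

(** Averaging the [(x + U i x) / 2] instead of the [U i x] makes the parallelogram law
    available term by term. *)
Definition average (s : seq I) (x : K) : K :=
  (2 * (size s)%:R)^-1 *: \sum_(i <- s) (x + U i x).

Lemma average_linear s : linear (average s).
Proof.
move=> a x y; rewrite /average scalerA [a * _]mulrC -scalerA -scalerDr; congr (_ *: _).
rewrite scaler_sumr -big_split /=; apply: eq_bigr => i _.
by rewrite linearP scalerDr addrACA.
Qed.
HB.instance Definition _ s :=
  GRing.isLinear.Build _ _ _ _ (average s) (average_linear s).

Lemma average_fixed s x : (0 < size s)%N ->
  (forall i, U i x = x) -> average s x = x.
Proof.
move=> s0 Ux; rewrite /average (eq_bigr (fun=> x *+ 2)) => [|i _]; last by rewrite Ux.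
rewrite big_const_seq count_predT iter_addr_0 -mulrnA.
rewrite -[_ *+ (2 * _)]scaler_nat scalerA natrM.
by rewrite mulVf ?scale1r// mulf_neq0 ?pnatr_eq0// -lt0n.
Qed.

Lemma average_fixed_inner s x y : (0 < size s)%N ->
  (forall i, U i y = y) -> form (average s x) y = form x y.
Proof.
move=> s0 Uy; rewrite linearZl_LR linear_sumlz /=.
rewrite (eq_bigr (fun=> form x y *+ 2)) => [|i _]; last first.
  by rewrite linearDl /= -{2}(Uy i) U_isometry.
rewrite big_const_seq count_predT iter_addr_0 -mulrnA.
rewrite -[_ *+ (2 * _)]mulr_natl mulrA natrM.
by rewrite mulVf ?mul1r// mulf_neq0 ?pnatr_eq0// -lt0n.
Qed.

Lemma ler_dot_norm_sum (s : seq I) (f : I -> K) :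
  dot_norm form (\sum_(i <- s) f i) <= \sum_(i <- s) dot_norm form (f i).
Proof.
elim: s => [|i s IHs]; first by rewrite !big_nil /dot_norm linear0l sqrtC0.
by rewrite !big_cons (le_trans (ler_dot_normD _ _ _))// lerD2l.
Qed.

Definition average_rate (s : seq I) (c : C) : C := 1 - (8 * (size s)%:R * c)^-1.

Lemma average_rateP s c : (0 < size s)%N -> 1 <= c ->
  0 <= average_rate s c /\ average_rate s c < 1.
Proof.
move=> s0 c1; have k1 : 1 <= 8 * (size s)%:R * c.
  apply: mulr_ege1 => //; rewrite -natrM ler1n muln_gt0 s0 //.
have k0 := lt_le_trans ltr01 k1.
by rewrite subr_ge0 invf_le1// k1 ltrBlDr ltrDl invr_gt0.
Qed.

(** By the parallelogram law the norm of [x + U i x] drops below [2 |x|] by an amount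
    governed by the displacement [|U i x - x|]. *)
Lemma average_contraction s c x : (0 < size s)%N -> 1 <= c ->
  form x x <= c * \sum_(i <- s) form (U i x - x) (U i x - x) ->
  dot_norm form (average s x) <= average_rate s c * dot_norm form x.
Proof.
move=> s0 c1 xgap; set N := dot_norm form x.
have [x0|x0] := eqVneq x 0.
  by rewrite /N x0 linear0 /dot_norm linear0l sqrtC0 mulr0.
have N0 : 0 < N by rewrite lt0r dot_norm_ge0 andbT /N /dot_norm sqrt_dnorm_eq0.
have c0 : 0 < c := lt_le_trans ltr01 c1.
have k0 : 0 < (size s)%:R :> C by rewrite ltr0n.
rewrite -(ler_pM2r N0).
(* This is the inequality [4 m N <= m^2 + 4 N^2] with [m = |x + U i x|]. *)
have mN i : dot_norm form (x + U i x) * N <=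
    2 * N ^+ 2 - form (U i x - x) (U i x - x) / 4.
  set m := dot_norm form _.
  have m0 : 0 <= m := dot_norm_ge0 _ _.
  have mE : m ^+ 2 = 4 * N ^+ 2 - form (U i x - x) (U i x - x).
    by rewrite !dot_norm_sqr dnormB dnormD U_isometry [form x (U i x)]dot_conj conjCK;
      ring.
  rewrite -subr_ge0.
  have -> : 2 * N ^+ 2 - form (U i x - x) (U i x - x) / 4 - m * N =
      4^-1 * (m - 2 * N) ^+ 2.
    have -> : form (U i x - x) (U i x - x) = 4 * N ^+ 2 - m ^+ 2.
      by rewrite mE; ring.
    by field.
  rewrite mulr_ge0 ?invr_ge0// real_exprn_even_ge0 ?rpredB ?ger0_real// mulr_ge0//.
  exact: ltW.
apply: le_trans (_ : (2 * (size s)%:R)^-1 *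
    \sum_(i <- s) (2 * N ^+ 2 - form (U i x - x) (U i x - x) / 4) <= _).
  rewrite /dot_norm; apply: (@le_trans _ _ ((2 * (size s)%:R)^-1 *
    (\sum_(i <- s) dot_norm form (x + U i x)) * N)).
    rewrite ler_wpM2r ?(ltW N0)// -/(dot_norm _ _) dot_normZ ger0_norm; last first.
      by rewrite invr_ge0 mulr_ge0// ltW.
    by rewrite ler_wpM2l ?ler_dot_norm_sum// invr_ge0 mulr_ge0// ltW.
  rewrite -mulrA ler_wpM2l//; first by rewrite invr_ge0 mulr_ge0// ltW.
  by rewrite mulr_suml ler_sum.
rewrite sumrB big_const_seq count_predT iter_addr_0 -mulr_suml.
set D := \sum_(i <- s) _ in xgap *.
have DN : N ^+ 2 / c <= D by rewrite ler_pdivrMr// mulrC dot_norm_sqr.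
rewrite -subr_ge0 /average_rate.
have -> : (1 - (8 * (size s)%:R * c)^-1) * N * N - (2 * (size s)%:R)^-1 *
    ((2 * N ^+ 2) *+ size s - D / 4) =
    (8 * (size s)%:R)^-1 * (D - N ^+ 2 / c).
  rewrite -mulr_natr; field.
  by rewrite !gt_eqF.
by rewrite mulr_ge0 ?subr_ge0// invr_ge0 mulr_ge0// ltW.
Qed.

(** If the displacement controls the norm on the orthocomplement of a fixed vector
    [e], the powers of the average converge in norm to the projection on [e]. *)
Lemma average_iter_cvg s c (e : K) : (0 < size s)%N -> 1 <= c ->
  (forall i, U i e = e) ->
  (forall x, form x e = 0 ->
    form x x <= c * \sum_(i <- s) form (U i x - x) (U i x - x)) ->
  forall m x, dot_norm form (iter m (average s) x - (form x e / form e e) *: e) <=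
    average_rate s c ^+ m * dot_norm form x.
Proof.
move=> s0 c1 Ue gap m x; set p := _ *: e.
have pe : form (x - p) e = 0.
  rewrite linearBl linearZl_LR /=; have [->|e0] := eqVneq e 0.
    by rewrite !linear0r mulr0 subrr.
  by rewrite divfK ?dnorm_eq0// subrr.
have pp : form (x - p) p = 0 by rewrite {2}/p linearZr_LR /= pe mulr0.
have ap : average s p = p by rewrite linearZ /= average_fixed.
have [r0 _] := average_rateP s0 c1.
suff [] : form (iter m (average s) x - p) e = 0 /\
  dot_norm form (iter m (average s) x - p) <= average_rate s c ^+ m * dot_norm form x.
  by [].
elim: m => [|m [IHe IHm]] /=.
  split=> //; rewrite expr0 mul1r -ler_sqr ?nnegrE ?dot_norm_ge0// !dot_norm_sqr.
  have -> : form x x = form (x - p) (x - p) + form p p.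
    by rewrite -{1 2}(subrK p x) dnormD pp conjC0 !addr0.
  by rewrite lerDl dnorm_ge0.
rewrite -ap -linearB /= average_fixed_inner//; split=> //.
rewrite exprS -mulrA; apply: le_trans (average_contraction s0 c1 (gap _ IHe)) _.
by rewrite ler_wpM2l.
Qed.

End Average.

(** * The algebra generated by a representation *)

Section BopTopology.
Variables (R : realType) (V : hilbertType R).
Implicit Types (S T : bop V) (A : set (bop V)).

Lemma bop_norm_le T (M : R[i]) : 0 <= M ->
  (forall u, `|T u| <= M * `|u|) -> `|T| <= M.
Proof. exact: opnorm_le. Qed.

Lemma bop_norm_ge T u : `|T u| <= `|T| * `|u|.
Proof. exact: ler_opnorm. Qed.

Lemma bop_normM S T : `|S * T| <= `|S| * `|T|.
Proof.
apply: bop_norm_le => [|u]; first by rewrite mulr_ge0.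
apply: le_trans (bop_norm_ge S (T u)) _.
by rewrite -mulrA ler_wpM2l// bop_norm_ge.
Qed.

Lemma lipschitz_cts (f : bop V -> bop V) (M : R[i]) : 0 <= M ->
  (forall S T, `|f S - f T| <= M * `|S - T|) -> continuous f.
Proof.
move=> M0 fM S B /nbhs_ballP[e /= e0 eB]; apply/nbhs_ballP.
have M10 : 0 < M + 1 by rewrite ltr_wpDl.
exists (e / (M + 1)) => [|T]; first by rewrite /= divr_gt0.
rewrite -ball_normE /= ltr_pdivlMr// mulrC => ST; apply: eB.
rewrite -ball_normE /=; apply: le_lt_trans ST.
by apply: le_trans (fM _ _) _; rewrite ler_wpM2r// lerDl.
Qed.

Lemma lipschitz_closure (f : bop V -> bop V) (M : R[i]) A B : 0 <= M ->
  (forall S T, `|f S - f T| <= M * `|S - T|) ->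
  closed B -> (forall T, A T -> B (f T)) -> forall T, closure A T -> B (f T).
Proof.
move=> M0 fM Bc AB.
have Bfc : closed (f @^-1` B).
  by apply: closed_comp Bc => T _; exact: lipschitz_cts fM T.
move=> T AT; suff : (f @^-1` B) T by [].
by apply: Bfc; exact: closure_subset AT.
Qed.

Lemma closed_approx A T : closed A ->
  (forall e : R[i], 0 < e -> exists2 S, A S & `|S - T| <= e) -> A T.
Proof.
move=> Ac AT; apply: Ac => B /nbhs_ballP[e /= e0 eB].
have e20 : 0 < e / 2 by rewrite divr_gt0.
have [S AS ST] := AT _ e20; exists S; split=> //; apply: eB.
rewrite -ball_normE /= distrC; apply: le_lt_trans ST _.
by rewrite ltr_pdivrMr// ltr_pMr// ltr1n.
Qed.

Lemma submod_closedP A : GRing.submod_closed (mem A) <->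
  (A 0 /\ forall a S T, A S -> A T -> A (a *: S + T)).
Proof.
split=> [[A0 AD]|[A0 AD]].
  split=> [|a S T AS AT]; apply/set_mem; first exact: A0.
  by apply: AD; exact/mem_set.
split=> [|a S T AS AT]; apply/mem_set => //.
by apply: AD; exact/set_mem.
Qed.

End BopTopology.

Section RepCstar.
Variables (R : realType) (G : groupType) (V : hilbertType R) (pi : unirep G V).
Local Notation A := (rep_cstar pi).

Let X := linear_span (range pi).

Let spanP a S T : X S -> X T -> X (a *: S + T).
Proof.
move=> [n [c [f [fP ->]]]] [m [d [g [gP ->]]]].
exists (n + m)%N.
exists (fun i => match fintype.split i with inl j => a * c j | inr j => d j end).
exists (fun i => match fintype.split i with inl j => f j | inr j => g j end); split.
  by move=> i; case: (fintype.split i).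
rewrite big_split_ord scaler_sumr /=; congr (_ + _); apply: eq_bigr => i _.
  by rewrite -[lshift _ _]/(unsplit (inl i)) unsplitK scalerA.
by rewrite -[rshift _ _]/(unsplit (inr i)) unsplitK.
Qed.

Let span0 : X 0.
Proof. by exists 0%N, (fun=> 0), (fun=> 0); split=> [[]//|]; rewrite big_ord0. Qed.

Lemma rep_cstar_closed : closed A. Proof. exact: closed_closure. Qed.

Lemma rep_cstar_rep g : A (pi g).
Proof.
apply: subset_closure; exists 1%N, (fun=> 1), (fun=> pi g); split.
  by move=> _; exists g.
by rewrite big_ord1 scale1r.
Qed.

Lemma rep_cstar_submod : A 0 /\ forall a S T, A S -> A T -> A (a *: S + T).
Proof.
split=> [|a S T AS AT]; first exact/subset_closure/span0.
apply: (@lipschitz_closure _ _ (fun S => a *: S + T) `|a| X) AS => //.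
- by move=> S1 S2; rewrite opprD addrACA subrr addr0 -scalerBr normrZ.
- exact: rep_cstar_closed.
move=> {}S XS; apply: (@lipschitz_closure _ _ (fun T => a *: S + T) 1 X) AT => //.
- by move=> T1 T2; rewrite opprD addrACA subrr add0r mul1r.
- exact: rep_cstar_closed.
by move=> {}T XT; apply: subset_closure; exact: spanP.
Qed.

Lemma rep_cstar_sum (I : Type) (s : seq I) (P : pred I) (c : I -> R[i]) T :
  (forall i, A (T i)) -> A (\sum_(i <- s | P i) c i *: T i).
Proof.
have [A0 AD] := rep_cstar_submod => AT.
by elim/big_rec: _ => // i S _; exact: AD.
Qed.

(** Multiplication is Lipschitz in each factor, so it suffices to multiply linear
    combinations of group elements, one factor at a time. *)
Lemma rep_cstar_mul S T : A S -> A T -> A (S * T).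
Proof.
move=> AS AT; apply: (@lipschitz_closure _ _ (fun S => S * T) `|T| X) AS => //.
- by move=> S1 S2; rewrite -mulrBl mulrC bop_normM.
- exact: rep_cstar_closed.
move=> _ [n [c [f [fP ->]]]]; rewrite mulr_suml.
under eq_bigr do rewrite -bop_scaleAl.
apply: rep_cstar_sum => i; have [g _ <-] := fP i.
apply: (@lipschitz_closure _ _ (fun T => pi g * T) `|pi g| X) AT => //.
- by move=> T1 T2; rewrite -mulrBr bop_normM.
- exact: rep_cstar_closed.
move=> _ [m [d [k [kP ->]]]]; rewrite mulr_sumr.
under eq_bigr do rewrite -bop_scaleAr.
apply: rep_cstar_sum => j; have [h _ <-] := kP j.
rewrite -unirepM; exact: rep_cstar_rep.
Qed.

Lemma rep_cstar_ideal : closed_ideal A A.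
Proof.
split=> //; first exact: rep_cstar_closed.
  exact/submod_closedP/rep_cstar_submod.
by move=> S T AS AT; split; exact: rep_cstar_mul.
Qed.

(** A non-zero element contained in every non-zero closed ideal makes the intersection
    of these ideals the smallest one. *)
Lemma smallest_nonzero_ideal_of_common (E : bop V) : A E -> E != 0 ->
  (forall J, closed_ideal A J -> (exists2 T, J T & T != 0) -> J E) ->
  exists! I, smallest_nonzero_ideal A I.
Proof.
move=> AE E0 JE; pose P J := closed_ideal A J /\ exists2 T, J T & T != 0.
have PA : P A by split; [exact: rep_cstar_ideal|exists E].
exists [set T | forall J, P J -> J T]; split.
  split.
  - split.
    + by move=> T; exact.
    + move=> T clT J PJ; have [[_ Jc _ _] _] := PJ; apply: Jc.
      by move: T clT; apply: closure_subset => T; exact.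
    + apply/submod_closedP; split=> [J [[_ _ /submod_closedP[]//]]|].
      move=> a S T IS IT J PJ; have [[_ _ /submod_closedP[_ JD] _] _] := PJ.
      by apply: JD; [exact: IS|exact: IT].
    + move=> S T AS IT; split=> J PJ; have [[_ _ _ JM] _] := PJ.
        by have [] := JM S T AS (IT _ PJ).
      by have [] := JM S T AS (IT _ PJ).
  - by exists E => // J [Ji Jn]; exact: JE.
  - by move=> J Ji Jn T; apply.
move=> I [Ii In Imin]; apply/seteqP; split=> [T|T IT J [Ji Jn]]; first exact.
exact: Imin IT.
Qed.

End RepCstar.

(** * The spectral gap as a bound by displacements *)

Lemma sqr_sum_le (C : numFieldType) (I : Type) (s : seq I) (x : I -> C) :
  (forall i, 0 <= x i) ->
  (\sum_(i <- s) x i) ^+ 2 <= (size s)%:R * \sum_(i <- s) x i ^+ 2.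
Proof.
move=> x0; elim: s => [|i s IHs]; first by rewrite !big_nil expr0n mul0r.
rewrite !big_cons /= sqrrD -natr1 mulrDl mul1r mulrDr.
have xs : (x i * \sum_(j <- s) x j) *+ 2 <=
    (size s)%:R * x i ^+ 2 + \sum_(j <- s) x j ^+ 2.
  have -> : (size s)%:R * x i ^+ 2 = \sum_(j <- s) x i ^+ 2.
    by rewrite big_const_seq count_predT iter_addr_0 mulr_natl.
  rewrite mulr_sumr -sumrMnl -big_split /=; apply: ler_sum => j _.
  rewrite -subr_ge0.
  have -> : x i ^+ 2 + x j ^+ 2 - (x i * x j) *+ 2 = (x i - x j) ^+ 2 by ring.
  by rewrite real_exprn_even_ge0 ?rpredB ?ger0_real.
have -> : (size s)%:R * x i ^+ 2 + (size s)%:R * \sum_(j <- s) x j ^+ 2 +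
    (x i ^+ 2 + \sum_(j <- s) x j ^+ 2) =
    x i ^+ 2 + ((size s)%:R * x i ^+ 2 + \sum_(j <- s) x j ^+ 2) +
    (size s)%:R * \sum_(j <- s) x j ^+ 2 by ring.
by rewrite lerD// lerD2l.
Qed.

Section WeakContainment.
Variables (R : realType) (G : groupType) (V : hilbertType R) (pi : unirep G V).

Lemma group_algebra_repE (W : hilbertType R) (rho : unirep G W) a u :
  group_algebra_rep rho a u = \sum_(g <- finsupp a) a g *: rho g u.
Proof. exact: bop_sumE. Qed.

(** The elements of the maximal C*-algebra are limits of elements of the group algebra,
    and a strict inequality of norms survives a small perturbation. *)
Lemma not_weakly_contained_norm (W : hilbertType R) (rho : unirep G W) :
  ~ weakly_contained rho pi -> exists a : group_algebra R G,
    `|group_algebra_rep pi a| < `|group_algebra_rep rho a|.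
Proof.
move=> /existsNP[x /negP]; rewrite -real_ltNge ?normr_real// => lt_x.
have e0 : 0 < (`|cstar_rep rho x| - `|cstar_rep pi x|) / 2.
  by rewrite divr_gt0// subr_gt0.
have /cvgrPdist_lt/(_ _ e0)[M _ xM] := @cstar_rep_cvg _ _ _ pi x.
have /cvgrPdist_lt/(_ _ e0)[N _ xN] := @cstar_rep_cvg _ _ _ rho x.
exists (x (maxn M N)).
have := xM (maxn M N) (leq_maxl _ _); have := xN (maxn M N) (leq_maxr _ _).
rewrite /= -/(cstar_rep pi x) -/(cstar_rep rho x).
set S := group_algebra_rep pi _; set T := group_algebra_rep rho _ => Te Se.
have S1 : `|S| < `|cstar_rep pi x| + (`|cstar_rep rho x| - `|cstar_rep pi x|) / 2.
  rewrite -{1}(subKr (cstar_rep pi x) S); apply: le_lt_trans (ler_normB _ _) _.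
  by rewrite ltrD2l.
have T1 : `|cstar_rep rho x| <
    `|T| + (`|cstar_rep rho x| - `|cstar_rep pi x|) / 2.
  rewrite -{1}(subrK T (cstar_rep rho x)) addrC.
  by apply: le_lt_trans (ler_normD _ _) _; rewrite ltrD2l.
apply: lt_trans S1 _; rewrite -(ltrD2r ((`|cstar_rep rho x| - `|cstar_rep pi x|) / 2)).
by apply: le_lt_trans T1; rewrite -addrA -splitr addrC subrK.
Qed.

Lemma trivial_rep_norm a :
  `|group_algebra_rep (trivial_rep R G) a| <= `|\sum_(g <- finsupp a) a g|.
Proof.
apply: bop_norm_le => // u; rewrite group_algebra_repE.
by rewrite -scaler_suml normrZ.
Qed.

(** If the trivial representation is not weakly contained in [pi], some element [a] of
    the group algebra has [|pi(a)| < |sum_g a(g)|]; as [pi(a)] acts on an almost invariant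
    vector nearly as the scalar [sum_g a(g)], almost invariant vectors cannot exist. *)
Lemma gap_displacement : ~ weakly_contained (trivial_rep R G) pi ->
  exists (s : seq G) (c : R[i]), 0 <= c /\
    forall u, `|u| ^+ 2 <= c * \sum_(g <- s) `|pi g u - u| ^+ 2.
Proof.
move=> /not_weakly_contained_norm[a].
move/lt_le_trans => /(_ _ (trivial_rep_norm a)); set m := \sum_(g <- _) _.
rewrite -subr_gt0; set D := `|m| - _ => D0.
pose B := \sum_(g <- finsupp a) `|a g|.
exists (finsupp a), ((B / D) ^+ 2 * (size (finsupp a))%:R).
have B0 : 0 <= B by apply: sumr_ge0.
split=> [|u]; first by rewrite mulr_ge0// exprn_ge0// divr_ge0// ltW.
have Du : D * `|u| <= B * \sum_(g <- finsupp a) `|pi g u - u|.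
  apply: (@le_trans _ _ `|m *: u - group_algebra_rep pi a u|).
    rewrite mulrBl -normrZ; apply: le_trans (lerB_dist _ _).
    by rewrite lerD2l lerN2 bop_norm_ge.
  rewrite group_algebra_repE scaler_suml -sumrB mulr_sumr.
  apply: le_trans (ler_norm_sum _ _ _) _; rewrite !big_seq; apply: ler_sum => g ga.
  rewrite -scalerBr normrZ distrC ler_wpM2r// /B (big_fsetD1 g)//= lerDl.
  exact: sumr_ge0.
have Du2 : `|u| ^+ 2 <= (B / D * \sum_(g <- finsupp a) `|pi g u - u|) ^+ 2.
  have s0 : 0 <= \sum_(g <- finsupp a) `|pi g u - u| by apply: sumr_ge0.
  rewrite ler_sqr ?nnegrE ?mulr_ge0 ?invr_ge0 ?(ltW D0)//.
  by rewrite mulrAC ler_pdivlMr// mulrC.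
apply: le_trans Du2 _; rewrite exprMn -[leRHS]mulrA ler_wpM2l ?exprn_ge0 ?divr_ge0 ?(ltW D0)//.
exact: sqr_sum_le.
Qed.

End WeakContainment.

(** * Functions supported on the subgroup *)

Section SumSingle.
Variables (R : realType) (X : choiceType).

Lemma sum_single (a : X -> R[i]) x0 :
  (forall x, x != x0 -> a x = 0) -> summability.sum a = a x0.
Proof.
move=> a0; apply: (cvg_lim (@norm_hausdorff _ R[i])).
apply/cvgrPdist_lt => e e0; exists [fset x0]%fset => // A /= /fsubsetP x0A.
rewrite partial_sumE (big_fsetD1 x0) ?x0A ?inE//= big_seq big1 ?addr0.
  by rewrite subrr normr0.
by move=> x; rewrite !inE => /andP[/a0].
Qed.

End SumSingle.

Section Induced.
Variables (R : realType) (G : groupType) (H : groupClosed G) (V : hilbertType R).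
Variable sigma : unirep (subgroup_of H) V.
Local Notation W := (ind_space sigma).
Local Notation pi := (ind_rep sigma).
Local Notation coset1 := (\pi_(lcosets H) 1%g).

Lemma ind_repE g (f : W) y : pi g f y = f (g^-1 * y)%g.
Proof. by []. Qed.

Definition ind_eval (g : G) (f : W) : V := f g.

Lemma ind_eval_linear g : linear (ind_eval g). Proof. by []. Qed.
HB.instance Definition _ g :=
  GRing.isLinear.Build _ _ _ _ (ind_eval g) (ind_eval_linear g).

Let restrict_rep1 : pi (val (1%g : subgroup_of H)) = 1.
Proof. exact: (unirep1 pi). Qed.
Let restrict_repM (h k : subgroup_of H) :
  pi (val (h * k)%g) = pi (val h) * pi (val k).
Proof. exact: (unirepM pi). Qed.
Definition ind_restrict : unirep (subgroup_of H) W :=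
  @Unirep _ _ _ (fun h => pi (val h)) restrict_rep1 restrict_repM
    (fun h => unirep_unitary pi (val h)).

Lemma ind_normE2 (f : W) : `|f| ^+ 2 = l2_inner (ind_l2 f) (ind_l2 f).
Proof. by rewrite ind_normE sqrtCK. Qed.

Lemma ind_partial_le (f : W) (A : {fset lcosets H}) :
  \sum_(x <- A) `|f (repr x)| ^+ 2 <= `|f| ^+ 2.
Proof. by rewrite ind_normE2; exact: (l2_inner_ge_partial (ind_l2 f)). Qed.

Lemma ind_partial_cvg (f : W) :
  (fun A : {fset lcosets H} => \sum_(x <- A) `|f (repr x)| ^+ 2) @ totally -->
  `|f| ^+ 2.
Proof.
rewrite ind_normE2; have := @l2_inner_cvg R (lcosets H) V (ind_l2 f) (ind_l2 f).
rewrite -/(l2_inner _ _); apply: cvg_trans; apply: near_eq_cvg; apply: nearW => A.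
by rewrite partial_sumE; apply: eq_bigr => x _; rewrite normr_inner_sqr.
Qed.

Let delta_fun (v : V) (g : G) : V :=
  if insub g is Some h then sigma (h : subgroup_of H)^-1%g v else 0.

Let delta_fun_in v (h : subgroup_of H) : delta_fun v (val h) = sigma h^-1%g v.
Proof. by rewrite /delta_fun valK. Qed.

Let delta_fun_out v g : g \notin H -> delta_fun v g = 0.
Proof. by move=> gH; rewrite /delta_fun insubN. Qed.

Let repr_in (x : lcosets H) : (repr x \in H) = (x == coset1).
Proof.
apply/idP/eqP => [xH|->].
  rewrite -[x]reprK; apply/esym/lcosetP; rewrite invg1 mul1g; exact: xH.
by rewrite -gpredV -[_^-1%g]mulg1; exact: lcoset_reprV.
Qed.

Let delta_subproof (v : V) : delta_fun v \in ind_pred sigma.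
Proof.
apply/asboolP; split=> [g h|].
  have [gH|gH] := boolP (g \in H).
    rewrite -[g]/(val (Sub g gH : subgroup_of H)) delta_fun_in.
    rewrite -[(_ * _)%g]/(val ((Sub g gH : subgroup_of H) * h)%g) delta_fun_in.
    by rewrite invgM unirepM.
  by rewrite !delta_fun_out ?linear0// gpredMr ?(valP h).
have dn x : `|delta_fun v (repr x)| ^+ 2 <= if x == coset1 then `|v| ^+ 2 else 0.
  rewrite -repr_in; case: ifPn => xH; last by rewrite delta_fun_out ?normr0 ?expr0n.
  by rewrite -[repr x]/(val (Sub (repr x) xH : subgroup_of H)) delta_fun_in unirep_norm.
exists (`|v| ^+ 2) => A; apply: le_trans (ler_sum _ (fun x _ => dn x)) _.
have [xA|xA] := boolP (coset1 \in A).
  rewrite (big_fsetD1 coset1)//= eqxx big_seq big1 ?addr0// => x.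
  by rewrite !inE => /andP[/negbTE ->].
rewrite big_seq big1 ?exprn_ge0// => x xA'; case: eqP => // x1.
by move: xA; rewrite -x1 xA'.
Qed.

(** The function supported on [H] with value [v] at the identity; the embedding of the
    representation space of [sigma] into the induced one. *)
Definition ind_delta (v : V) : W := IndSpace (delta_subproof v).

Lemma ind_delta1 v : ind_delta v 1%g = v.
Proof. by rewrite -[1%g]/(val (1%g : subgroup_of H)) [LHS]delta_fun_in invg1 unirep1. Qed.

Lemma ind_delta_out v g : g \notin H -> ind_delta v g = 0.
Proof. exact: delta_fun_out. Qed.

Lemma ind_on_subgroup (f : W) (h : subgroup_of H) : f (val h) = sigma h^-1%g (f 1%g).
Proof. by rewrite -ind_equivariant mul1g. Qed.

(** [ind_delta] is adjoint to the evaluation at the identity. *)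
Lemma inner_ind_delta f v : inner f (ind_delta v) = inner (f 1%g) v.
Proof.
rewrite -[LHS]/(ind_inner _ _) /ind_inner (@sum_single _ _ _ coset1) => [|x x1].
  have rH : repr coset1 \in H by rewrite repr_in.
  rewrite -[repr coset1]/(val (Sub (repr coset1) rH : subgroup_of H)).
  by rewrite !ind_on_subgroup unirep_unitary ind_delta1.
by rewrite ind_delta_out ?linear0r// repr_in.
Qed.

Lemma inner_ind_translate_delta f g v : inner f (pi g (ind_delta v)) = inner (f g) v.
Proof.
by rewrite -{1}[g]invgK -unirep_adjoint inner_ind_delta ind_repE invgK mulg1.
Qed.

Lemma ind_delta_linear : linear ind_delta.
Proof.
move=> a u v; apply: (@dot_nondegenerate _ _ inner) => f.
by rewrite linearDr linearZr_LR /= !inner_ind_delta linearDr linearZr_LR.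
Qed.
HB.instance Definition _ :=
  GRing.isLinear.Build _ _ _ _ ind_delta ind_delta_linear.

Lemma ind_delta_intertwines h v : ind_delta (sigma h v) = ind_restrict h (ind_delta v).
Proof.
apply: (@dot_nondegenerate _ _ inner) => f.
rewrite inner_ind_translate_delta inner_ind_delta ind_on_subgroup.
by rewrite unirep_adjoint invgK.
Qed.

Lemma ind_eval_intertwines h (f : W) :
  ind_eval 1%g (ind_restrict h f) = sigma h (ind_eval 1%g f).
Proof.
rewrite -[LHS]/(f ((val h)^-1 * 1)%g) mulg1.
by rewrite -[(val h)^-1%g]/(val h^-1%g) ind_on_subgroup invgK.
Qed.

Lemma ind_delta_isometry u v : inner (ind_delta u) (ind_delta v) = inner u v.
Proof. by rewrite inner_ind_delta ind_delta1. Qed.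

Lemma ind_translate_delta_repr (x y : lcosets H) v :
  x != y -> pi (repr x) (ind_delta v) (repr y) = 0.
Proof.
move=> xy; rewrite ind_repE ind_delta_out//; apply: contra xy => h.
by rewrite -[x]reprK -[y]reprK; apply/eqP/lcosetP.
Qed.

(** The translates of the functions supported on [H] span a dense subspace: the
    restriction of [f] to finitely many cosets lies in it, and its distance to [f]
    tends to zero. *)
Lemma bop_ind_eq0 (T : bop W) :
  (forall g v, T (pi g (ind_delta v)) = 0) -> T = 0.
Proof.
move=> T0; apply: bop_eqP => f; apply/eqP; rewrite -normr_eq0 -sqrf_eq0.
rewrite eq_le exprn_ge0// andbT.
pose fA (A : {fset lcosets H}) : W :=
  \sum_(x <- A) pi (repr x) (ind_delta (f (repr x))).
have fAf A : `|f - fA A| ^+ 2 = `|f| ^+ 2 - \sum_(x <- A) `|f (repr x)| ^+ 2.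
  have ffA : inner f (fA A) = \sum_(x <- A) `|f (repr x)| ^+ 2.
    rewrite linear_sumr; apply: eq_bigr => x _.
    by rewrite /= inner_ind_translate_delta normr_inner_sqr.
  have fAr x : x \in A -> fA A (repr x) = f (repr x).
    move=> xA; rewrite -[LHS]/(ind_eval (repr x) (fA A)) linear_sum.
    rewrite (big_fsetD1 x)//= big_seq big1 ?addr0 => [|y].
      rewrite -[LHS]/(ind_delta (f (repr x)) ((repr x)^-1 * repr x)%g).
      by rewrite mulVg ind_delta1.
    by rewrite !inE => /andP[yx _]; exact: ind_translate_delta_repr.
  have fAfA : inner (fA A) (fA A) = \sum_(x <- A) `|f (repr x)| ^+ 2.
    rewrite {2}/fA linear_sumr !big_seq; apply: eq_bigr => x xA.
    by rewrite /= inner_ind_translate_delta fAr// normr_inner_sqr.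
  rewrite !normr_inner_sqr dnormB fAfA ffA geC0_conj; last first.
    by apply: sumr_ge0 => x _; exact: exprn_ge0.
  by rewrite opprD addrA addrK.
have Tle (A : {fset lcosets H}) : `|T f| ^+ 2 <=
    `|T| ^+ 2 * (`|f| ^+ 2 - \sum_(x <- A) `|f (repr x)| ^+ 2).
  have -> : T f = T (f - fA A).
    by rewrite linearB linear_sum big1 ?subr0// => x _; exact: T0.
  by rewrite -fAf -exprMn ler_sqr ?nnegrE ?mulr_ge0// bop_norm_ge.
have : (fun A : {fset lcosets H} =>
    `|T| ^+ 2 * (`|f| ^+ 2 - \sum_(x <- A) `|f (repr x)| ^+ 2)) @ totally -->
    `|T| ^+ 2 * (`|f| ^+ 2 - `|f| ^+ 2).
  apply: cvgM; first exact: cvg_cst.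
  by apply: cvgB; [exact: cvg_cst|exact: ind_partial_cvg].
rewrite subrr mulr0 => /complex_cvg_ge; apply; exact: nearW.
Qed.

End Induced.

(** * Displacement bounds for the induced representation *)

Lemma ler_dist_dot_norm (C : numClosedFieldType) (E : lmodType C)
    (form : {dot E for Num.Def.conjC}) u v :
  `|dot_norm form u - dot_norm form v| <= dot_norm form (u - v).
Proof.
rewrite real_ler_norml ?rpredB ?ger0_real ?dot_norm_ge0//; apply/andP; split.
  rewrite lerNl opprB lerBlDr.
  have -> : dot_norm form (u - v) = dot_norm form (v - u).
    by rewrite -(opprB v u) -[- (v - u)]scaleN1r dot_normZ normrN1 mul1r.
  by rewrite -{1}(subrK u v) ler_dot_normD.
by rewrite lerBlDr -{1}(subrK v u) ler_dot_normD.
Qed.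

Section DisplacementContraction.
Variables (R : realType) (H : groupType) (V : hilbertType R) (sigma : unirep H V).
Variables (n : nat) (e : 'I_n -> V).
Variables (W W' : hilbertType R) (pi : unirep H W) (pi' : unirep H W').
Variable A : {linear W -> W'}.
Hypothesis Api : forall h u, A (pi h u) = pi' h (A u).
Hypothesis Ale : forall u, `|A u| ^+ 2 <= `|u| ^+ 2.

Lemma displacement_contraction s T :
  displacement sigma e pi' s (A \o T) <= displacement sigma e pi s T.
Proof.
apply: ler_sum => h _; rewrite -(hom_act_natural sigma e Api) !hs_inner_sqr.
apply: ler_sum => j _.
rewrite -[X in `|X| ^+ 2 <= _]/(A (hom_act sigma e pi h T j) - A (T j)) -linearB.
exact: Ale.
Qed.

End DisplacementContraction.

Section InducedGap.
Variables (R : realType) (G : groupType) (H : groupClosed G) (V : hilbertType R).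
Variable sigma : unirep (subgroup_of H) V.
Variables (n : nat) (e : 'I_n -> V).
Hypotheses (eo : is_orthonormal inner e) (eb : expands_on inner e predT).
Local Notation W := (ind_space sigma).
Local Notation pi_H := (ind_restrict sigma).
Local Notation X := (punctured_lcosets H).
Implicit Types T : 'I_n -> W.

Definition radial_fun T (x : X) : R[i] :=
  dot_norm (@hs_inner R n V) (fun j => T j (repr (val x))).

Lemma radial_fun_sqr T x :
  `|radial_fun T x| ^+ 2 = \sum_j `|T j (repr (val x))| ^+ 2.
Proof. by rewrite ger0_norm ?dot_norm_ge0// dot_norm_sqr; exact: hs_inner_sqr. Qed.

Lemma radial_partial_le T (A : {fset X}) :
  \sum_(x <- A) `|radial_fun T x| ^+ 2 <= hs_inner T T.
Proof.
under eq_bigr do rewrite radial_fun_sqr.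
rewrite exchange_big hs_inner_sqr; apply: ler_sum => j _ /=.
have <- := @big_imfset _ 0 +%R _ _ imfset_key val (mem A)
  (fun y => `|T j (repr y)| ^+ 2).
  exact: ind_partial_le.
by move=> x y _ _; exact: val_inj.
Qed.

Let radial_subproof T : radial_fun T \in @sqsummable_pred R X R[i].
Proof. by apply/asboolP; exists (hs_inner T T) => A; exact: radial_partial_le. Qed.

(** Passing to pointwise norms turns tuples of vector-valued functions into scalar
    functions on the punctured coset space.  It commutes with the actions and does not
    increase distances, so the spectral gap, which concerns scalar functions, applies
    to tuples. *)
Definition radial T : l2 X R[i] := L2 (radial_subproof T).

Lemma radial_fun_act T h x :
  radial_fun T (punctured_action H h^-1%g x) =
  radial_fun (hom_act sigma e pi_H h T) x.
Proof.
rewrite /radial_fun /dot_norm; congr sqrtC.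
transitivity (hs_inner (fun j => T j ((val h)^-1 * repr (val x))%g)
  (fun j => T j ((val h)^-1 * repr (val x))%g)).
  rewrite /= !hs_inner_sqr; apply: eq_bigr => j _.
  by have [k ->] := ind_translate_repr (T j) (val h) (val x); rewrite unirep_norm.
rewrite -(hom_mix_isometry sigma eo eb h); congr hs_inner; apply/funext => j;
  rewrite -[RHS]/(ind_eval _ _) linear_sum; apply: eq_bigr => i _;
  by rewrite linearZ.
Qed.

Lemma radial_displacement T h :
  `|perm_rep R (punctured_action H) h (radial T) - radial T| ^+ 2 <=
  hs_inner (hom_act sigma e pi_H h T - T) (hom_act sigma e pi_H h T - T).
Proof.
rewrite normr_inner_sqr; apply: l2_inner_le => A.
apply: le_trans (radial_partial_le (hom_act sigma e pi_H h T - T) A).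
apply: ler_sum => x _.
rewrite -[X in `|X| ^+ 2 <= _]/(radial_fun T (punctured_action H h^-1%g x) -
  radial_fun T x) radial_fun_act.
rewrite ler_sqr ?nnegrE// [leRHS]ger0_norm ?dot_norm_ge0//.
exact: ler_dist_dot_norm.
Qed.

Lemma radial_norm_ge T : (forall j, T j 1%g = 0) ->
  hs_inner T T <= `|radial T| ^+ 2.
Proof.
move=> T1; rewrite hs_inner_sqr.
apply: (@complex_cvg_le _ _ totally (fun A : {fset lcosets H} =>
    \sum_j \sum_(x <- A) `|T j (repr x)| ^+ 2)).
  by apply: cvg_sum_seq => j; exact: ind_partial_cvg.
apply: nearW => A; rewrite exchange_big /=.
have T0 (x : lcosets H) : ~~ (x != \pi_(lcosets H) 1%g) ->
    \sum_j `|T j (repr x)| ^+ 2 = 0.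
  rewrite negbK => /eqP ->; apply: big1 => j _.
  have rH : repr (\pi_(lcosets H) 1%g) \in H.
    by rewrite -gpredV -[_^-1%g]mulg1; exact: lcoset_reprV.
  rewrite -[repr _]/(val (Sub (repr (\pi_(lcosets H) 1%g)) rH : subgroup_of H)).
  by rewrite ind_on_subgroup T1 linear0 normr0 expr0n.
(* The coset of the identity contributes nothing; the others come from [X]. *)
rewrite (bigID (fun x => x != \pi_(lcosets H) 1%g)) /=.
rewrite [X in _ + X]big1 ?addr0; last first.
  by move=> x; exact: T0.
rewrite -big_filter.
have -> : [seq x <- A | x != \pi_(lcosets H) 1%g] = [seq val x | x : X <- pmap insub A].
  rewrite (pmap_filter (@insubK _ _ X)); apply: eq_filter => x.
  by case: insubP => [u -> //|/negbTE ->].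
have s_uniq : uniq (pmap insub A : seq X).
  by apply: (@pmap_sub_uniq _ _ X); exact: fset_uniq.
rewrite big_map -[X in \sum_(x <- X) _](undup_id s_uniq).
rewrite -(perm_big _ (seq_fset_perm tt _)).
under eq_bigr do rewrite -radial_fun_sqr.
exact: (l2_norm_ge_partial (radial T)).
Qed.

(** For tuples vanishing on [H] the pointwise norm retains the whole norm, so the
    scalar bound given by the spectral gap transfers to them. *)
Lemma punctured_gap : spectral_gap_property R H ->
  exists (s : seq (subgroup_of H)) (c : R[i]), 0 <= c /\
  forall T, (forall j, T j 1%g = 0) ->
    hs_inner T T <= c * displacement sigma e pi_H s T.
Proof.
move=> /gap_displacement[s [c [c0 gap]]]; exists s, c; split=> // T T1.
apply: le_trans (radial_norm_ge T1) _; apply: le_trans (gap _) _.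
by rewrite ler_wpM2l//; apply: ler_sum => h _; exact: radial_displacement.
Qed.

(** The part of [f] supported off [H]; together with [ind_eval 1] it splits the induced
    space orthogonally and [H]-equivariantly. *)
Definition ind_off (f : W) : W := f - ind_delta sigma (ind_eval 1%g f).

Lemma ind_off_linear : linear ind_off.
Proof.
move=> a f g; rewrite /ind_off.
rewrite -[ind_eval _ (_ + _)]/(a *: ind_eval 1%g f + ind_eval 1%g g).
by rewrite (linearP (ind_delta sigma)) /= scalerBr opprD addrACA.
Qed.
HB.instance Definition _ := GRing.isLinear.Build _ _ _ _ ind_off ind_off_linear.

Lemma ind_off_norm f : `|f| ^+ 2 = `|ind_off f| ^+ 2 + `|ind_eval 1%g f| ^+ 2.
Proof.
rewrite !normr_inner_sqr dnormB ind_delta_isometry inner_ind_delta.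
rewrite -/(ind_eval 1%g f) geC0_conj ?dnorm_ge0//; ring.
Qed.

Lemma ind_off_intertwines h f : ind_off (pi_H h f) = pi_H h (ind_off f).
Proof.
by rewrite /ind_off ind_eval_intertwines ind_delta_intertwines -linearB.
Qed.

(** Split a tuple into its part on [H], where irreducibility of [sigma] bounds the
    norm, and its part off [H], where the spectral gap does. *)
Lemma induced_gap : irreducible sigma -> spectral_gap_property R H ->
  exists (s : seq (subgroup_of H)) (c : R[i]), [/\ (0 < size s)%N, 1 <= c &
  forall T, hs_inner T (ind_delta sigma \o e) = 0 ->
    hs_inner T T <= c * displacement sigma e pi_H s T].
Proof.
move=> /irreducible_gap/(_ _ _ eo eb)[s1 [c1 [c10 gap1]]].
move=> /punctured_gap[s2 [c2 [c20 gap2]]].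
(* The identity is there to make the list non-empty. *)
exists (1%g :: s1 ++ s2), (1 + (c1 *+ 2 + c2 *+ 2)); split=> // [|T Te].
  by rewrite lerDl addr_ge0 ?mulrn_wge0.
pose T1 : 'I_n -> V := ind_eval 1%g \o T.
pose T2 : 'I_n -> W := ind_off \o T.
have TE : T = (ind_delta sigma \o T1) + T2.
  by apply/funext => j; rewrite -[RHS]/(_ + (T j - _)) addrC subrK.
have T1e : hs_inner T1 e = 0.
  by rewrite -Te; apply: eq_bigr => j _; rewrite inner_ind_delta.
have T1T1 : hs_inner (ind_delta sigma \o T1) (ind_delta sigma \o T1) = hs_inner T1 T1.
  by apply: eq_bigr => j _; exact: ind_delta_isometry.
have T21 j : T2 j 1%g = 0.
  by rewrite -[LHS]/(T j 1%g - ind_delta sigma (T j 1%g) 1%g) ind_delta1 subrr.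
have d1 s : displacement sigma e sigma s T1 <= displacement sigma e pi_H s T.
  apply: displacement_contraction => [h f|f]; first exact: ind_eval_intertwines.
  by rewrite ind_off_norm lerDr exprn_ge0.
have d2 s : displacement sigma e pi_H s T2 <= displacement sigma e pi_H s T.
  apply: displacement_contraction => [h f|f]; first exact: ind_off_intertwines.
  by rewrite [leRHS]ind_off_norm lerDl exprn_ge0.
rewrite {1 2}TE; apply: le_trans (dnormD_le (@hs_inner R n W) _ _) _; rewrite /= T1T1.
rewrite mulrDl mul1r -[leLHS]add0r lerD ?displacement_ge0//.
rewrite -cat1s displacement_cat displacement_cat mulrDl !mulrnAl lerD// lerMn2r /=.
  apply: le_trans (gap1 _ T1e) _; rewrite ler_wpM2l//.
  apply: le_trans (d1 _) _; rewrite addrCA lerDl addr_ge0 ?displacement_ge0//.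
apply: le_trans (gap2 _ T21) _; rewrite ler_wpM2l//.
apply: le_trans (d2 _) _; rewrite addrA lerDr addr_ge0 ?displacement_ge0//.
Qed.

End InducedGap.

(** * Rank-one operators in the algebra *)

Lemma complex_expr_small (R : realType) (r d : R[i]) : 0 <= r -> r < 1 -> 0 < d ->
  exists m, r ^+ m <= d.
Proof.
move=> r0 r1 d0.
have rE : r = (complex.Re r)%:C%C by rewrite RRe_real// ger0_real.
have dE : d = (complex.Re d)%:C%C by rewrite RRe_real// gtr0_real.
have Rr : `|complex.Re r| < 1.
  by rewrite ger0_norm -?ltcR -?rE// -ler0c -rE.
have Rd : 0 < complex.Re d by rewrite -ltcR -dE.
have /cvgrPdist_lt/(_ _ Rd)[m _ /(_ m (leqnn m))] := cvg_expr Rr.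
rewrite /= sub0r normrN => /ltW rm; exists m.
rewrite rE dE -rmorphXn lecR; apply: le_trans rm; exact: ler_norm.
Qed.

Section RankOneInAlgebra.
Variables (R : realType) (G : groupType) (H : groupClosed G) (V : hilbertType R).
Variable sigma : unirep (subgroup_of H) V.
Hypotheses (sigma_irr : irreducible sigma) (H_gap : spectral_gap_property R H).
Variables (n : nat) (e : 'I_n -> V).
Hypotheses (eo : is_orthonormal inner e) (eb : expands_on inner e predT).
Local Notation W := (ind_space sigma).
Local Notation pi_H := (ind_restrict sigma).
Local Notation A := (rep_cstar (ind_rep sigma)).
Local Notation iota := (ind_delta sigma).

Let U (h : subgroup_of H) : {linear ('I_n -> W) -> ('I_n -> W)} :=
  hom_act sigma e pi_H h.

(** Each step of the average only composes on the left with operators [pi h] and takes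
    linear combinations with coefficients independent of [f], hence it can be carried
    out on tuples of operators of the algebra before they are evaluated at [f]. *)
Lemma average_rep_cstar s m (B : 'I_n -> bop W) : (forall i, A (B i)) ->
  exists B' : 'I_n -> bop W, (forall i, A (B' i)) /\
    forall f, iter m (average U s) (fun i => B i f) = fun i => B' i f.
Proof.
have [A0 AD] := rep_cstar_submod (ind_rep sigma).
move=> AB; elim: m => [|m [B' [AB' B'E]]]; first by exists B.
pose B2 j : bop W := (2 * (size s)%:R)^-1 *: (\sum_(h <- s) 1 *: (1 *: B' j +
  \sum_i inner (sigma h^-1%g (e j)) (e i) *: (ind_rep sigma (val h) * B' i))).
exists B2; split=> [j|f].
  rewrite /B2 -[_ *: _]addr0; apply: (AD) => //; apply: rep_cstar_sum => h.
  apply: (AD) => //; apply: rep_cstar_sum => i; apply: rep_cstar_mul => //.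
  exact: rep_cstar_rep.
rewrite iterS B'E; apply/funext => j; rewrite -[LHS]/((2 * (size s)%:R)^-1 *:
  (\sum_(h <- s) ((fun i => B' i f) + U h (fun i => B' i f))) j) fct_sumE.
rewrite /B2; set C : bop W := \sum_(h <- s) _.
rewrite -[RHS]/((2 * (size s)%:R)^-1 *: C f) bop_sumE.
congr (_ *: _); apply: eq_bigr => h _.
rewrite !scale1r; set D : bop W := \sum_i _.
by rewrite -[RHS]/(B' j f + D f) bop_sumE.
Qed.

(** Applied to the matrix units, the powers of the average converge in norm to the
    rank-one operators between vectors of the image of [iota]. *)
Lemma rank_one_basis_rep_cstar l j : A (rank_one (iota (e l)) (iota (e j))).
Proof.
have [A0 AD] := rep_cstar_submod (ind_rep sigma).
have [s [c [s0 c1 gap]]] := induced_gap eo eb sigma_irr H_gap.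
have n0 : n%:R != 0 :> R[i] by rewrite pnatr_eq0 -lt0n (basis_nonempty sigma_irr eb).
suff : A (n%:R^-1 *: rank_one (iota (e l)) (iota (e j))).
  move=> /(AD n%:R _ 0)/(_ A0); rewrite addr0 scalerA divff// scale1r.
  exact.
have [r0 r1] := average_rateP s0 c1.
apply: closed_approx => [|d d0]; first exact: rep_cstar_closed.
have [m rm] := complex_expr_small r0 r1 d0.
have [B [AB BE]] : exists B : 'I_n -> bop W, (forall i, A (B i)) /\
    forall i f, B i f = if i == j then f else 0.
  exists (fun i => if i == j then ind_rep sigma 1%g else 0); split=> [i|i f].
    by case: eqP => _ //; exact: rep_cstar_rep.
  by case: eqP => // _; rewrite unirep1.
have [B' [AB' B'E]] := average_rep_cstar s m AB.
exists (B' l) => //; apply: bop_norm_le => [|f]; first exact: ltW.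
have -> : (B' l - n%:R^-1 *: rank_one (iota (e l)) (iota (e j))) f =
    B' l f - (inner f (iota (e j)) / n%:R) *: iota (e l).
  rewrite -[LHS]/(B' l f - n%:R^-1 *: (inner f (iota (e j)) *: iota (e l))).
  by rewrite scalerA mulrC.
have Uiso h x y : hs_inner (U h x) (U h y) = hs_inner x y.
  exact: (hom_act_isometry sigma eo eb).
have Ufix h : U h (iota \o e) = iota \o e.
  by apply: (hom_act_intertwiner eb) => k v; exact: ind_delta_intertwines.
have := average_iter_cvg (form := @hs_inner R n W) Uiso s0 c1 Ufix gap m (fun i => B i f).
rewrite B'E /=.
have -> : hs_inner (iota \o e) (iota \o e) = n%:R.
  rewrite /hs_inner; under eq_bigr do rewrite /= ind_delta_isometry eo eqxx.
  by rewrite sumr_const card_ord.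
have -> : hs_inner (fun i => B i f) (iota \o e) = inner f (iota (e j)).
  rewrite /hs_inner (bigD1 j)//= BE eqxx big1 ?addr0// => i ij.
  by rewrite BE (negbTE ij) linear0l.
have -> : dot_norm (@hs_inner R n W) (fun i => B i f) = `|f|.
  rewrite normr_inner /dot_norm /= /hs_inner (bigD1 j)//= BE eqxx big1 ?addr0// => i ij.
  by rewrite BE (negbTE ij) linear0l.
set D := (X in dot_norm _ X) => D_le.
apply: (@le_trans _ _ (dot_norm (@hs_inner R n W) D)); last first.
  by apply: le_trans D_le _; rewrite ler_wpM2r.
rewrite -[X in `|X| <= _]/(D l).
rewrite -ler_sqr ?nnegrE ?dot_norm_ge0// [leRHS]dot_norm_sqr.
rewrite -[leRHS]/(hs_inner D D) hs_inner_sqr (bigD1 l)//=.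
by rewrite lerDl; apply: sumr_ge0 => i _; exact: exprn_ge0.
Qed.

Lemma rank_one_rep_cstar u v : A (rank_one (iota u) (iota v)).
Proof.
have -> : rank_one (iota u) (iota v) = \sum_l inner u (e l) *:
    \sum_j (inner v (e j))^* *: rank_one (iota (e l)) (iota (e j)).
  apply: bop_eqP => f; rewrite bop_sumE rank_oneE !inner_ind_delta.
  rewrite {1}(eb (u := u))// linear_sum scaler_sumr; apply: eq_bigr => l _.
  rewrite -[RHS]/(_ *: (\sum_j _ : bop W) f) bop_sumE.
  rewrite {1}(eb (u := v))// linear_sumr linearZ scaler_suml scaler_sumr /=.
  apply: eq_bigr => j _; rewrite -[RHS]/(inner u (e l) *: ((inner v (e j))^* *:
    (inner f (iota (e j)) *: iota (e l)))).
  rewrite inner_ind_delta linearZr_LR /= !scalerA; congr (_ *: _); ring.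
apply: rep_cstar_sum => l; apply: rep_cstar_sum => j.
exact: rank_one_basis_rep_cstar.
Qed.

(** A non-zero [T] has a non-zero matrix coefficient between translates of functions
    supported on [H]; compressing it by rank-one operators and translations gives a
    non-zero multiple of a fixed rank-one operator. *)
Lemma rank_one_ideal J u : closed_ideal A J -> (exists2 T, J T & T != 0) ->
  J (rank_one (iota u) (iota u)).
Proof.
move=> [_ _ /submod_closedP[J0 JD] JM] [T JT T0].
have [g [v Tv]] : exists g v, T (ind_rep sigma g (iota v)) != 0.
  apply: contrapT => Tn; move/eqP: T0; apply; apply: bop_ind_eq0 => g v.
  by apply: contrapT => /eqP Tv; apply: Tn; exists g, v.
set w : W := T _ in Tv.
have [k wk] : exists k, w k != 0.
  apply: contrapT => wn; move/eqP: Tv; apply; apply/val_inj/funext => k.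
  by apply: contrapT => /eqP wk; apply: wn; exists k.
have Api x : A (ind_rep sigma x) by exact: rep_cstar_rep.
pose S := rank_one (iota u) (iota (w k)) *
  (ind_rep sigma k^-1%g * (T * (ind_rep sigma g * rank_one (iota v) (iota u)))).
have JS : J S.
  apply: (JM _ _ _ _).1; first exact: rank_one_rep_cstar.
  apply: (JM _ _ _ _).1; first exact: Api.
  by apply: (JM _ _ _ JT).2; apply: rep_cstar_mul => //; exact: rank_one_rep_cstar.
have SE : S = inner (w k) (w k) *: rank_one (iota u) (iota u).
  apply: bop_eqP => f.
  rewrite -[LHS]/(inner (ind_rep sigma k^-1%g (T (ind_rep sigma g
    (inner f (iota u) *: iota v)))) (iota (w k)) *: iota u).
  rewrite -[RHS]/(_ *: (inner f (iota u) *: iota u)); set a := inner f (iota u).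
  have -> : ind_rep sigma k^-1%g (T (ind_rep sigma g (a *: iota v))) =
    a *: ind_rep sigma k^-1%g w by rewrite !linearZ.
  rewrite inner_ind_delta -[X in inner X _]/(a *: w (k^-1^-1 * 1)%g).
  by rewrite invgK mulg1 linearZl_LR scalerA mulrC.
have ww : inner (w k) (w k) != 0 by rewrite dnorm_eq0.
have := JD (inner (w k) (w k))^-1 _ _ JS J0.
by rewrite addr0 SE scalerA mulVf// scale1r.
Qed.

End RankOneInAlgebra.

Theorem theorem7p4 (R : realType) (G : groupType) (hG : countable [set: G])
  (H : groupClosed G) (hH : spectral_gap_property R H)
  (V : hilbertType R) (sigma : unirep (subgroup_of H) V)
  (sigma_fin : finite_dimensional V) (sigma_irr : irreducible sigma) :
  exists! Imin : set (bop (ind_space sigma)),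
    smallest_nonzero_ideal (rep_cstar (ind_rep sigma)) Imin.
Proof.
have [N [b span]] := sigma_fin.
have [n [e [_ eo eb]]] := @orthonormal_basis _ _ (@inner R V) _ b predT span
  (conj isT (fun _ _ _ _ _ => isT)).
have [[u u0] _] := sigma_irr.
have AE : rep_cstar (ind_rep sigma) (rank_one (ind_delta sigma u) (ind_delta sigma u)).
  exact: (@rank_one_rep_cstar _ _ _ _ _ sigma_irr hH _ e).
apply: (smallest_nonzero_ideal_of_common AE) => [|J].
  apply: contra u0 => /eqP E0.
  have : rank_one (ind_delta sigma u) (ind_delta sigma u) (ind_delta sigma u) = 0.
    by rewrite E0.
  rewrite rank_oneE ind_delta_isometry => /(congr1 (fun f : ind_space sigma => f 1%g)).
  rewrite -[LHS]/(_ *: ind_delta sigma u 1%g) ind_delta1 => /eqP.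
  by rewrite scaler_eq0 dnorm_eq0 orbb.
exact: (rank_one_ideal sigma_irr hH eo eb).
Qed.
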